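(* Let $(R,\mathfrak m)$ be a Noetherian local ring of dimension $d\ge 1$ with infinite residue field $R/\mathfrak m$. Let $I$ be an $\mathfrak m$-primary ideal and let $\mathcal I=\{I_n\}_{n\in\mathbb Z}$ be an $I$-admissible filtration. Let $\underline{x}=x_1,\ldots,x_d$ be elements of $I$ such that $(x_1,\ldots,x_d)\subseteq I$ is a minimal reduction of $\mathcal I$. Then $$e_1(\mathcal I)=\sum_{n=1}^{\infty}\chi\bigl(K^{(n)}(\underline{x},\mathcal I)\bigr).$$
   Context: Conventions: $\lambda$ denotes length as an $R$-module, and $I^n=R$ for $n\le 0$. A sequence of ideals $\mathcal I=\{I_n\}_{n\in\mathbb Z}$ is an $I$-admissible filtration if there is $k\in\mathbb N$ such that for all $m,n\in\mathbb Z$: $I_{n+1}\subseteq I_n$, $I_mI_n\subseteq I_{m+n}$, and $I^n\subseteq I_n\subseteq I^{n-k}$. In particular $I_n=R$ for $n\le 0$. For large $n$ the Hilbert function $H_{\mathcal I}(n)=\lambda(R/I_n)$ agrees with a polynomial $P_{\mathcal I}(x)\in\mathbb Q[x]$ of degree $d$, written $$P_{\mathcal I}(x)=e_0(\mathcal I)\binom{x+d-1}{d}-e_1(\mathcal I)\binom{x+d-2}{d-1}+\cdots+(-1)^d e_d(\mathcal I)$$ with uniquely determined integers $e_i(\mathcal I)$; $e_1(\mathcal I)$ is called the Chern number of $\mathcal I$. A reduction of $\mathcal I$ is an ideal $J\subseteq I_1$ such that $JI_n=I_{n+1}$ for all large $n$. A minimal reduction is a reduction minimal with respect to inclusion; since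 $R/\mathfrak m$ is infinite, minimal reductions exist and are generated by $d$ elements. For $n\in\mathbb Z$, $K^{(n)}(\underline{x},\mathcal I)$ is the subcomplex of the Koszul complex $K_\bullet(\underline{x})$ of $x_1,\ldots,x_d$ on $R$ given by $$0\to I_{n-d}\to (I_{n-d+1})^{\binom{d}{1}}\to\cdots\to (I_{n-1})^{\binom{d}{d-1}}\to I_n\to 0,$$ that is, its term in homological degree $i$ is $(I_{n-i})^{\binom{d}{i}}\subseteq R^{\binom{d}{i}}=K_i(\underline{x})$, with the restricted Koszul differentials. Its Euler characteristic is $$\chi(K^{(n)}(\underline{x},\mathcal I))=\sum_{i=0}^d(-1)^i\lambda\bigl(H_i(K^{(n)}(\underline{x},\mathcal I))\bigr).$$ *)

(* Defs.v *)
From HB Require Import structures.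
From mathcomp Require Import all_boot all_order all_algebra.
From mathcomp Require Import boolp classical_sets functions cardinality.

Set Implicit Arguments.
Unset Strict Implicit.
Unset Printing Implicit Defensive.

Import Order.TTheory GRing.Theory Num.Theory.
Local Open Scope classical_set_scope.
Local Open Scope ring_scope.

Section Modules.
Context {R : comNzRingType} {V : lmodType R}.

Definition submodule (N : set V) : Prop :=
  [/\ N 0, forall u v, N u -> N v -> N (u + v)
    & forall (a : R) u, N u -> N (a *: u)].

(* Submodules of the quotient module N / M are the L / M for L a submodule of V
   with M `<=` L `<=` N.  Hence [submodule_chain M N l c] is a strict chain of
   submodules of N / M, of length l, from 0 to N / M. *)
Definition submodule_chain (M N : set V) (l : nat) (c : nat -> set V) : Prop :=
  [/\ c 0 = M, c l = N, forall i, (i <= l)%N -> submodule (c i)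
    & forall i, (i < l)%N -> c i `<` c i.+1].

Definition is_length (M N : set V) (l : nat) : Prop :=
  (exists c, submodule_chain M N l c) /\
  (forall l' c, submodule_chain M N l' c -> (l' <= l)%N).

Definition finite_length (M N : set V) : Prop := exists l, is_length M N l.

(* The length of N / M; it is 0 by convention if that length is infinite. *)
Definition length_quo (M N : set V) : nat := xget 0%N [set l | is_length M N l].

End Modules.

Section Ideals.
Context {R : comNzRingType}.
Implicit Types (A B I J P m : set R).

Definition ideal (A : set R) : Prop := submodule (A : set R^o).

Definition ideal_span (G : set R) : set R := smallest ideal G.

Definition ideal_mul A B : set R :=
  ideal_span [set a * b | a in A & b in B].

Definition ideal_exp I (n : nat) : set R := iter n (ideal_mul I) setT.

Definition ideal_expz I (n : int) : set R :=
  if n is Posz k then ideal_exp I k else setT.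

Definition prime_ideal P : Prop :=
  [/\ ideal P, P != setT & forall a b, P (a * b) -> P a \/ P b].

Definition maximal_ideal m : Prop :=
  [/\ ideal m, m != setT
    & forall J, ideal J -> m `<=` J -> J = m \/ J = setT].

Definition radical I : set R := [set a | exists n : nat, I (a ^+ n)].

Definition primary_ideal I : Prop :=
  [/\ ideal I, I != setT & forall a b, I (a * b) -> I a \/ radical I b].

Definition primary_to m I : Prop := primary_ideal I /\ radical I = m.

Definition reduction_of (Is : int -> set R) J : Prop :=
  [/\ ideal J, J `<=` Is 1
    & exists N : int, forall n : int, N <= n ->
        ideal_mul J (Is n) = Is (n + 1)].

Definition minimal_reduction_of (Is : int -> set R) J : Prop :=
  reduction_of Is J /\
  (forall J', reduction_of Is J' -> J' `<=` J -> J' = J).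

Definition admissible_filtration I (Is : int -> set R) : Prop :=
  (forall n, ideal (Is n)) /\
  exists k : nat, forall m n : int,
    [/\ Is (n + 1) `<=` Is n, ideal_mul (Is m) (Is n) `<=` Is (m + n),
        ideal_expz I n `<=` Is n & Is n `<=` ideal_expz I (n - k%:Z)].

End Ideals.

Definition noetherian (R : comNzRingType) : Prop :=
  forall J : set R, ideal J -> exists s : seq R, J = ideal_span [set` s].

Definition local_ring (R : comNzRingType) (m : set R) : Prop :=
  maximal_ideal m /\ forall m' : set R, maximal_ideal m' -> m' = m.

Definition prime_chain (R : comNzRingType) (l : nat) (p : nat -> set R) : Prop :=
  (forall i, (i <= l)%N -> prime_ideal (p i)) /\
  (forall i, (i < l)%N -> p i `<` p i.+1).

Definition krull_dim (R : comNzRingType) (d : nat) : Prop :=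
  (exists p : nat -> set R, prime_chain d p) /\
  (forall l (p : nat -> set R), prime_chain l p -> (l <= d)%N).

Definition quotient_cosets (R : comNzRingType) (m : set R) : set (set R) :=
  range (fun a : R => [set b | m (b - a)]).

Section HilbertPolynomial.
Context {R : comNzRingType}.
Variables (d : nat) (Is : int -> set R).

Definition hilbert_fun (n : int) : nat :=
  length_quo (Is n : set R^o) (setT : set R^o).

Definition is_hilbert_poly (P : {poly rat}) : Prop :=
  exists N : nat, forall n : nat, (N <= n)%N ->
    (hilbert_fun n%:Z)%:R = P.[n%:R].

Definition hilbert_poly : {poly rat} := xget 0 [set P | is_hilbert_poly P].

(* The polynomial binom(X + a, b). *)
Definition binom_poly (a : int) (b : nat) : {poly rat} :=
  (b`!%:R)^-1 *: \prod_(j < b) ('X + (a%:~R - j%:R)%:P).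

Definition is_hilbert_coefs (e : {ffun 'I_d.+1 -> int}) : Prop :=
  hilbert_poly =
    \sum_(i < d.+1)
      ((-1) ^+ i * (e i)%:~R) *: binom_poly (d%:Z - i%:Z - 1) (d - i).

Definition hilbert_coefs : {ffun 'I_d.+1 -> int} :=
  xget 0 [set e | is_hilbert_coefs e].

Definition chern_number : int := hilbert_coefs (inord 1).

End HilbertPolynomial.

Section Koszul.
Context {R : comNzRingType} {d : nat}.
Variables (x : 'I_d -> R) (Is : int -> set R).

(* The total module of the Koszul complex, i.e. the exterior algebra of R^d:
   u stands for the sum of the u S e_S, where e_S = e_(j1) /\ ... /\ e_(ji) for
   S = {j1 < ... < ji}.  The term of homological degree i consists of the u
   supported on the sets S of cardinality i. *)
Definition koszul := {ffun {set 'I_d} -> R^o}.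

(* d(e_S) = sum_k (-1)^(k-1) x_(jk) e_(S \ jk), written coefficientwise. *)
Definition koszul_diff (u : koszul) : koszul :=
  [ffun T : {set 'I_d} =>
    \sum_(j | j \notin T)
      (-1) ^+ #|[pred k in T | (k < j)%N]| * x j * u (j |: T)%SET].

Definition koszul_sub (n : int) (i : nat) : set koszul :=
  [set u | forall S : {set 'I_d},
    if #|S| == i then Is (n - i%:Z) (u S) else u S = 0].

Definition koszul_cycles (n : int) (i : nat) : set koszul :=
  [set u | koszul_sub n i u /\ koszul_diff u = 0].

Definition koszul_boundaries (n : int) (i : nat) : set koszul :=
  koszul_diff @` koszul_sub n i.+1.

Definition koszul_homology_finite (n : int) (i : nat) : Prop :=
  finite_length (koszul_boundaries n i) (koszul_cycles n i).

Definition koszul_homology_length (n : int) (i : nat) : nat :=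
  length_quo (koszul_boundaries n i) (koszul_cycles n i).

Definition koszul_euler (n : int) : int :=
  \sum_(i < d.+1) (-1) ^+ i * (koszul_homology_length n i)%:Z.

End Koszul.

(* Convergence in the discrete space of integers: the partial sums of
   u 1 + u 2 + ... are eventually constant, equal to l. *)
Definition int_series_sum (u : nat -> int) (l : int) : Prop :=
  exists N : nat, forall M : nat, (N <= M)%N -> \sum_(1 <= n < M.+1) u n = l.

(* Main.v *)
(* For N large the complex K^(N) is acyclic: by the Artin-Rees lemma the cycles
   satisfy Z_i(N+1) = (x) Z_i(N), and x_j z = d(e_j /\ z) for a cycle z.  Hence
   for n <= N the complexes K^(n) and K^(n)/K^(N) have the same homology, and the
   latter has terms of finite length, so that, H being the Hilbert function and
   D f n = f n - f (n - 1),
     chi(K^(n)) = (D^d H)(N) - (D^d H)(n).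
   Thus D^d H is constant, equal to some e_0, for large n.  This shows that the
   Hilbert polynomial exists (of degree at most d) and, by telescoping, that the
   sum of the chi(K^(n)) over 1 <= n <= M is e_0 M - (D^(d-1) H)(M) = e_1. *)
Require Import Defs.
From mathcomp Require Import all_boot all_order all_algebra.
From mathcomp Require Import boolp classical_sets functions cardinality.
From mathcomp Require Import ring zify.

Set Implicit Arguments.
Unset Strict Implicit.
Unset Printing Implicit Defensive.

Import Order.TTheory GRing.Theory Num.Theory.
Local Open Scope classical_set_scope.
Local Open Scope ring_scope.

(** * Length *)

(** The term of degree i of K^(n)/K^(N) has length C(d,i) (H(N-i) - H(n-i)), and the alternating sum
    of these over i is a difference of two values of D^d H. The binomials of the Hilbert polynomial
    are normalised so that D lowers d by one and keeps the remaining coefficients; hence D^(d-1) H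
    is eventually e_0 n - e_1. The sum from 1 to M telescopes without a correction term because H,
    and with it D^(d-1) H, vanishes at all n <= 0. The main obstacle is Artin-Rees. No Rees algebra
    is built: a graded module is a family of submodules of one fixed module, on which elements of R
    act with degree 1. An element may have several expressions as a polynomial in such an a, so the
    leading coefficients in Hilbert's basis theorem belong to expressions and not to elements.
    Likewise no quotient is formed: all lengths are lengths of intervals in a lattice of submodules,
    and the homology of K^(n)/K^(N) is replaced by a comparison of the cycles and boundaries of
    K^(n) and K^(N). *)

Section Submodules.
Context {R : comNzRingType} {V : lmodType R}.
Implicit Types (A B C M N X Y : set V).

Definition submodule_add A B : set V := [set a + b | a in A & b in B].

Lemma submodule0 A : submodule A -> A 0. Proof. by case. Qed.

Lemma submoduleD A u v : submodule A -> A u -> A v -> A (u + v).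
Proof. by case=> _ h _; apply: h. Qed.

Lemma submoduleZ A a u : submodule A -> A u -> A (a *: u).
Proof. by case=> _ _; apply. Qed.

Lemma submoduleN A u : submodule A -> A u -> A (- u).
Proof. by move=> sA Au; rewrite -scaleN1r; apply: submoduleZ. Qed.

Lemma submoduleB A u v : submodule A -> A u -> A v -> A (u - v).
Proof. by move=> sA Au Av; apply: submoduleD => //; apply: submoduleN. Qed.

Lemma submodule_sum A (T : finType) (P : pred T) (f : T -> V) :
  submodule A -> (forall i, P i -> A (f i)) -> A (\sum_(i | P i) f i).
Proof.
move=> sA; apply: (big_ind A); first exact: submodule0.
by move=> u v; apply: submoduleD.
Qed.

Lemma submodule_set0 : submodule [set (0 : V)].
Proof.
split=> // [u v -> ->|a u ->]; [exact: addr0|exact: scaler0].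
Qed.

Lemma submodule_setI A B : submodule A -> submodule B -> submodule (A `&` B).
Proof.
move=> sA sB; split.
- by split; apply: submodule0.
- by move=> u v [? ?] [? ?]; split; apply: submoduleD.
- by move=> a u [? ?]; split; apply: submoduleZ.
Qed.

Lemma submodule_add_closed A B :
  submodule A -> submodule B -> submodule (submodule_add A B).
Proof.
move=> sA sB; split.
- exists 0; first exact: submodule0; exists 0; first exact: submodule0.
  exact: addr0.
- move=> _ _ [a Aa [b Bb <-]] [a' Aa' [b' Bb' <-]].
  exists (a + a'); first exact: submoduleD.
  exists (b + b'); first exact: submoduleD.
  exact: addrACA.
- move=> k _ [a Aa [b Bb <-]].
  exists (k *: a); first exact: submoduleZ.
  exists (k *: b); first exact: submoduleZ.
  by rewrite scalerDr.
Qed.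

Lemma sub_submodule_addl A B : submodule B -> A `<=` submodule_add A B.
Proof.
move=> sB a Aa; exists a => //; exists 0; first exact: submodule0.
exact: addr0.
Qed.

Lemma sub_submodule_addr A B : submodule A -> B `<=` submodule_add A B.
Proof.
move=> sA b Bb; exists 0; first exact: submodule0.
by exists b => //; rewrite add0r.
Qed.

Lemma submodule_add_sub A B C :
  submodule C -> A `<=` C -> B `<=` C -> submodule_add A B `<=` C.
Proof.
by move=> sC AC BC _ [a /AC Ca [b /BC Cb <-]]; apply: submoduleD.
Qed.

Lemma submodule_addS A B C : A `<=` B -> submodule_add A C `<=` submodule_add B C.
Proof. by move=> AB _ [a /AB Ba [c Cc <-]]; exists a => //; exists c. Qed.

(** This keeps strict inclusions strict: a proper step from X to Y must be visible either after
    intersecting with B or after adding B. *)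
Lemma modular_law_sub B X Y : submodule X -> submodule Y -> X `<=` Y ->
  Y `&` B `<=` X -> Y `<=` submodule_add X B -> Y `<=` X.
Proof.
move=> sX sY XY YBX YXB y Yy; have [x Xx [b Bb xby]] := YXB y Yy.
rewrite -xby; apply: submoduleD => //; apply: YBX; split=> //.
by have -> : b = y - x; [rewrite -xby addrAC subrr add0r|apply: submoduleB => //; apply: XY].
Qed.

End Submodules.

(** * Lengths as bounds on strict chains, and their additivity *)

Section Chains.
Context {R : comNzRingType} {V : lmodType R}.
Implicit Types (A B C M N X Y : set V).

Definition chainable M N l := exists c, submodule_chain M N l c.

Lemma chainable0 M N : chainable M N 0 <-> M = N /\ submodule M.
Proof.
split=> [[c [<- <- h _]]|[<- sM]]; first by split=> //; apply: h.
by exists (fun=> M); split.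
Qed.

Lemma chainableS M N l :
  chainable M N l.+1 <-> exists X, [/\ chainable M X l, X `<` N & submodule N].
Proof.
split=> [[c [c0 cl cs clt]]|[X [[c [c0 cl cs clt]] XN sN]]].
  exists (c l); split; [|by rewrite -cl; apply: clt|by rewrite -cl; apply: cs].
  by exists c; split=> // i il; [apply: cs|apply: clt]; apply: leq_trans il _.
exists (fun i => if (i <= l)%N then c i else N); split=> [//||i il|i il].
- by rewrite ltnn.
- by case: ifP => // /cs.
- have -> : (i <= l)%N by [].
  case: (ltnP i l) => [|li]; first exact: clt.
  by rewrite (_ : i = l) ?cl //; lia.
Qed.

Lemma chainable_submodule M N l : chainable M N l -> submodule M /\ submodule N.
Proof.
by case=> c [<- <- h _]; split; apply: h.
Qed.

Lemma chainable_sub M N l : chainable M N l -> M `<=` N.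
Proof.
elim: l N => [|l IHl] N; first by move=> /chainable0[-> _] a.
by move=> /chainableS[X [/IHl MX [XN _] _]] a /MX/XN.
Qed.

Lemma chainable_cat A B C k l :
  chainable A B k -> chainable B C l -> chainable A C (k + l).
Proof.
move=> AB; elim: l C => [|l IHl] C; first by move=> /chainable0[<-]; rewrite addn0.
move=> /chainableS[X [/IHl AX XC sC]]; rewrite addnS; apply/chainableS.
by exists X.
Qed.

Lemma chainable1 A B : submodule A -> submodule B -> A `<=` B ->
  exists l, chainable A B l.
Proof.
move=> sA sB AB; have [BA|BA] := pselect (B `<=` A).
  by exists 0%N; apply/chainable0; split=> //; apply/seteqP.
by exists 1%N; apply/chainableS; exists A; split=> //; apply/chainable0.
Qed.

Lemma chainable_extend A B C l : chainable A B l -> submodule C -> B `<=` C ->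
  exists2 l', (l <= l')%N & chainable A C l'.
Proof.
move=> AB sC BC; have [_ sB] := chainable_submodule AB.
have [k BCk] := chainable1 sB sC BC.
by exists (l + k)%N; [exact: leq_addr|exact: chainable_cat BCk].
Qed.

(** By the modular law each strict step of the chain survives in its trace on B or in its sum with
    B, so the two induced chains together have at least l steps. This is the upper bound in the
    additivity of length. *)
Lemma chainable_split A B X l : submodule B -> A `<=` B -> chainable A X l ->
  exists k k', [/\ (l <= k + k')%N, chainable A (X `&` B) k
    & chainable B (submodule_add X B) k'].
Proof.
move=> sB AB; elim: l X => [|l IHl] X.
  move=> /chainable0[<- sA]; exists 0%N, 0%N; split=> //.
    by apply/chainable0; split=> //; apply/seteqP; split=> [a Aa|a []//]; split=> //; apply: AB.
  apply/chainable0; split=> //; apply/seteqP; split; first exact: sub_submodule_addr.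
  exact: submodule_add_sub.
move=> /chainableS[Y [AYl [YX XY] sX]].
have [_ sY] := chainable_submodule AYl.
have [k [k' [lk AYk BYk']]] := IHl _ AYl.
have sXB := submodule_setI sX sB.
have sXpB := submodule_add_closed sX sB.
have YBXB : Y `&` B `<=` X `&` B by move=> y [/YX ? ?].
have YpBXpB : submodule_add Y B `<=` submodule_add X B by apply: submodule_addS.
(* If the traces on B differ, the new step is counted in [k]; otherwise the sums with B must differ
   and it is counted in [k']. The other chain is merely prolonged. *)
have [h|h] := pselect (X `&` B `<=` Y `&` B); last first.
  have [k'' k'k'' BX] := chainable_extend BYk' sXpB YpBXpB.
  exists k.+1, k''; split=> //; first lia.
  by apply/chainableS; exists (Y `&` B).
have [k'' k'k'' AX] := chainable_extend AYk sXB YBXB.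
exists k'', k'.+1; split=> //; first lia.
apply/chainableS; exists (submodule_add Y B); split=> //; split=> // XYB.
apply: XY; apply: (modular_law_sub (B := B)) => //.
  by move=> x /h[].
by move=> x /(sub_submodule_addl sB)/XYB.
Qed.

Definition chain_bounded M N L := forall l, chainable M N l -> (l <= L)%N.

Lemma chain_bounded_finite M N L : submodule M -> submodule N -> M `<=` N ->
  chain_bounded M N L -> finite_length M N.
Proof.
move=> sM sN MN bound; have [l0 MNl0] := chainable1 sM sN MN.
have ex : exists l, `[< chainable M N l >] by exists l0; apply/asboolP.
have ub l : `[< chainable M N l >] -> (l <= L)%N by move=> /asboolP/bound.
case: (ex_maxnP ex ub) => l /asboolP MNl lmax; exists l; split=> // l' c' c'P.
by apply: lmax; apply/asboolP; exists c'.
Qed.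

Lemma is_length_bounded M N l : is_length M N l -> chain_bounded M N l.
Proof. by case=> _ h l' [c]; apply: h. Qed.

Lemma is_lengthP M N l :
  is_length M N l <-> chainable M N l /\ chain_bounded M N l.
Proof.
split=> [h|[h1 h2]]; first by split; [case: h|exact: is_length_bounded].
by split=> // l' c cP; apply: h2; exists c.
Qed.

Lemma is_length_uniq M N l l' : is_length M N l -> is_length M N l' -> l = l'.
Proof.
move=> /is_lengthP[h1 h2] /is_lengthP[h1' h2'].
by apply/eqP; rewrite eqn_leq; apply/andP; split; [exact: h2'|exact: h2].
Qed.

Lemma length_quoE M N l : is_length M N l -> length_quo M N = l.
Proof.
move=> MNl; rewrite /length_quo; case: xgetP => [l' _ MNl'|/(_ l)//].
exact: is_length_uniq MNl' MNl.
Qed.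

Lemma length_quoP M N : finite_length M N -> is_length M N (length_quo M N).
Proof. by case=> l MNl; rewrite (length_quoE MNl). Qed.

Lemma is_lengthxx M : submodule M -> is_length M M 0.
Proof.
move=> sM; apply/is_lengthP; split; first exact/chainable0.
case=> // l /chainableS[X [/chainable_sub MX [_ XM] _]].
by exfalso; apply: XM.
Qed.

Lemma is_length_add A B C k l :
  is_length A B k -> is_length B C l -> is_length A C (k + l).
Proof.
move=> /is_lengthP[ABk kmax] /is_lengthP[BCl lmax]; apply/is_lengthP.
split; first exact: chainable_cat BCl.
move=> n ACn; have [sA sB] := chainable_submodule ABk.
have [_ sC] := chainable_submodule BCl.
have AB := chainable_sub ABk; have BC := chainable_sub BCl.
have [i [j [nij Ai Bj]]] := chainable_split sB AB ACn.
apply: leq_trans nij _; apply: leq_add.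
- by apply: kmax; rewrite (_ : B = C `&` B) //; apply/esym/setIidr.
- apply: lmax; rewrite (_ : C = submodule_add C B) //.
  apply/seteqP; split; first exact: sub_submodule_addl.
  exact: submodule_add_sub.
Qed.

Lemma finite_length_add A B C :
  finite_length A B -> finite_length B C -> finite_length A C.
Proof. by move=> [k ABk] [l BCl]; exists (k + l)%N; apply: is_length_add BCl. Qed.

Lemma finite_length_sub A B C D :
  [/\ submodule A, submodule B, submodule C & submodule D] ->
  A `<=` B -> B `<=` C -> C `<=` D ->
  finite_length A D -> finite_length B C.
Proof.
move=> [sA sB sC sD] AB BC CD [l /is_length_bounded lmax].
apply: (@chain_bounded_finite _ _ l) => // k BCk.
have [i ABi] := chainable1 sA sB AB; have [j CDj] := chainable1 sC sD CD.
have := lmax _ (chainable_cat (chainable_cat ABi BCk) CDj); lia.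
Qed.

Lemma length_quo_add A B C :
  [/\ submodule A, submodule B & submodule C] -> A `<=` B -> B `<=` C ->
  finite_length A C ->
  length_quo A C = (length_quo A B + length_quo B C)%N.
Proof.
move=> [sA sB sC] AB BC fAC; apply: length_quoE; apply: is_length_add.
- by apply: length_quoP; apply: finite_length_sub fAC.
- by apply: length_quoP; apply: finite_length_sub fAC.
Qed.

Lemma length_quoxx A : submodule A -> length_quo A A = 0%N.
Proof. by move=> /is_lengthxx/length_quoE. Qed.

End Chains.

(** * Transfer of lengths between lattices of submodules *)

Section LengthTransfer.
Context {R : comNzRingType}.

Lemma chainable_map (V V' : lmodType R) (f : set V -> set V') M N l :
  (forall X, submodule X -> M `<=` X -> X `<=` N -> submodule (f X)) ->
  (forall X Y, submodule X -> submodule Y -> M `<=` X -> X `<` Y -> Y `<=` N ->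
     f X `<` f Y) ->
  chainable M N l -> chainable (f M) (f N) l.
Proof.
elim: l N => [|l IHl] N fsub flt.
  move=> /chainable0[MN sM]; apply/chainable0; split; first by rewrite MN.
  by apply: fsub; rewrite // -MN.
move=> /chainableS[X [MXl XN sN]]; have [sM sX] := chainable_submodule MXl.
have MX := chainable_sub MXl; apply/chainableS; exists (f X); split.
- apply: IHl MXl => [Y sY MY YX|Y Z sY sZ MY YZ ZX].
    by apply: fsub => // y /YX /(properW XN).
  by apply: flt => // y /ZX /(properW XN).
- exact: flt.
- by apply: fsub => // y /MX /(properW XN).
Qed.

(** Length depends only on the ordered set of submodules between the two ends, so mutually inverse
    monotone maps suffice; they need not come from a linear map. *)
Lemma is_length_iso (V V' : lmodType R) (f : set V -> set V')
    (g : set V' -> set V) M N M' N' l :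
  f M = M' -> f N = N' -> g M' = M -> g N' = N ->
  (forall X, submodule X -> M `<=` X -> X `<=` N ->
     submodule (f X) /\ g (f X) = X) ->
  (forall X, submodule X -> M' `<=` X -> X `<=` N' ->
     submodule (g X) /\ f (g X) = X) ->
  {homo f : X Y / X `<=` Y} -> {homo g : X Y / X `<=` Y} ->
  is_length M N l <-> is_length M' N' l.
Proof.
move=> fM fN gM gN fP gP fmono gmono.
have h k : chainable M N k <-> chainable M' N' k.
  split.
    rewrite -fM -fN; apply: chainable_map => [X sX MX XN|X Y sX sY MX [XY YX] YN].
      by have [] := fP X sX MX XN.
    have XN : X `<=` N by move=> u /XY/YN.
    have MY : M `<=` Y by move=> u /MX/XY.
    have [[_ gfX] [_ gfY]] := (fP X sX MX XN, fP Y sY MY YN).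
    by split=> [|/gmono]; [exact: fmono|rewrite gfX gfY].
  rewrite -gM -gN; apply: chainable_map => [X sX MX XN|X Y sX sY MX [XY YX] YN].
    by have [] := gP X sX MX XN.
  have XN : X `<=` N' by move=> u /XY/YN.
  have MY : M' `<=` Y by move=> u /MX/XY.
  have [[_ fgX] [_ fgY]] := (gP X sX MX XN, gP Y sY MY YN).
  by split=> [|/fmono]; [exact: gmono|rewrite fgX fgY].
rewrite !is_lengthP; split=> -[/h ? hb]; split=> // k /h; exact: hb.
Qed.

End LengthTransfer.

Section LengthLinear.
Context {R : comNzRingType}.

Lemma finite_length_iff (V V' : lmodType R) (M N : set V) (M' N' : set V') :
  (forall l, is_length M N l <-> is_length M' N' l) ->
  finite_length M N -> finite_length M' N' /\ length_quo M N = length_quo M' N'.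
Proof.
move=> h [l MNl]; have MNl' := (h l).1 MNl.
by split; [exists l|rewrite (length_quoE MNl) (length_quoE MNl')].
Qed.

Lemma is_length_second_iso (V : lmodType R) (A B : set V) l :
  submodule A -> submodule B ->
  is_length (A `&` B) A l <-> is_length B (submodule_add A B) l.
Proof.
move=> sA sB.
apply: (@is_length_iso _ _ _ (fun X => submodule_add X B) (fun Y => Y `&` A)).
- apply/seteqP; split; last by apply: sub_submodule_addr; apply: submodule_setI.
  by apply: submodule_add_sub => // x [].
- by [].
- by rewrite setIC.
- by apply: setIidr; apply: sub_submodule_addl.
- move=> X sX ABX XA; split; first exact: submodule_add_closed.
  apply/seteqP; split=> x.
    move=> [[u Xu [b Bb <-]] Aub]; apply: submoduleD => //; apply: ABX; split=> //.
    rewrite (_ : b = u + b - u); last by rewrite addrAC subrr add0r.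
    by apply: submoduleB => //; apply: XA.
  by move=> Xx; split; [exact: sub_submodule_addl|exact: XA].
- move=> X sX BX XAB; split; first exact: submodule_setI.
  apply/seteqP; split=> x.
    by apply: submodule_add_sub => // y [].
  move=> Xx; have [a Aa [b Bb abx]] := XAB x Xx.
  exists a; last by exists b.
  split=> //; rewrite (_ : a = x - b); last by rewrite -abx addrK.
  by apply: submoduleB => //; apply: BX.
- by move=> X Y XY; apply: submodule_addS.
- by move=> X Y XY u [/XY].
Qed.

Variables (V V' : lmodType R) (f : V -> V').
Hypothesis f_linear : linear f.
Implicit Types (A B M N X : set V).

Definition linear_kernel : set V := [set u | f u = 0].

Let fD u v : f (u + v) = f u + f v.
Proof. by have := f_linear 1 u v; rewrite !scale1r. Qed.

Let f0 : f 0 = 0.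
Proof. by apply: (addrI (f 0)); rewrite -fD !addr0. Qed.

Let fZ a u : f (a *: u) = a *: f u.
Proof. by have := f_linear a u 0; rewrite f0 !addr0. Qed.

Let fB u v : f (u - v) = f u - f v.
Proof. by rewrite fD -scaleN1r fZ scaleN1r. Qed.

Lemma submodule_linear_kernel : submodule linear_kernel.
Proof.
split=> [|u v fu fv|a u fu]; first exact: f0.
- by rewrite /linear_kernel /= fD fu fv addr0.
- by rewrite /linear_kernel /= fZ fu scaler0.
Qed.

Lemma submodule_image A : submodule A -> submodule (f @` A).
Proof.
move=> sA; split; first by exists 0; [exact: submodule0|exact: f0].
- by move=> _ _ [u Au <-] [v Av <-]; exists (u + v); [exact: submoduleD|exact: fD].
- by move=> a _ [u Au <-]; exists (a *: u); [exact: submoduleZ|exact: fZ].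
Qed.

Lemma submodule_preimage (Y : set V') : submodule Y -> submodule (f @^-1` Y).
Proof.
move=> sY; split; first by rewrite /preimage /= f0; exact: submodule0.
- by move=> u v Yu Yv; rewrite /preimage /= fD; apply: submoduleD.
- by move=> a u Yu; rewrite /preimage /= fZ; apply: submoduleZ.
Qed.

(** The correspondence theorem: the kernel of [f] on [N] lies in [M], so a submodule between them is
    recovered from its image. *)
Lemma is_length_image M N l : submodule M -> submodule N -> M `<=` N ->
  N `&` linear_kernel `<=` M ->
  is_length M N l <-> is_length (f @` M) (f @` N) l.
Proof.
move=> sM sN MN NkM.
have preimK X : submodule X -> M `<=` X -> X `<=` N ->
    (f @^-1` (f @` X)) `&` N = X.
  move=> sX MX XN; apply/seteqP; split=> u.
    move=> [[v Xv fvu] Nu]; rewrite -(subrK v u); apply: submoduleD => //.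
    apply/MX/NkM; split; first by apply: submoduleB => //; apply: XN.
    by rewrite /linear_kernel /= fB fvu subrr.
  by move=> Xu; split; [exists u|exact: XN].
apply: (@is_length_iso _ _ _ (fun X => f @` X) (fun Y => (f @^-1` Y) `&` N)) => //.
- exact: preimK.
- exact: preimK.
- move=> X sX MX XN; split; [exact: submodule_image|exact: preimK].
- move=> Y sY MY YN; split.
    by apply: submodule_setI => //; apply: submodule_preimage.
  apply/seteqP; split=> y; first by move=> [u [Yu _] <-].
  by move=> Yy; have [u Nu fuy] := YN y Yy; exists u => //; split=> //=; rewrite fuy.
- by move=> X Y XY; apply: image_subset.
- by move=> X Y XY u [/XY].
Qed.

(** Insert (N [&] ker f) + M between M and N. The lower interval is that of the kernels by the
    second isomorphism theorem; the upper one maps isomorphically to the images, since the inserted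
    module contains the kernel of f on N and has the same image as M. *)
Lemma length_rank_nullity M N : submodule M -> submodule N -> M `<=` N ->
  finite_length M N ->
  [/\ finite_length (M `&` linear_kernel) (N `&` linear_kernel),
      finite_length (f @` M) (f @` N)
    & length_quo M N = (length_quo (M `&` linear_kernel) (N `&` linear_kernel)
                        + length_quo (f @` M) (f @` N))%N].
Proof.
move=> sM sN MN fMN; have sK := submodule_linear_kernel.
pose NK := N `&` linear_kernel; have sNK : submodule NK by exact: submodule_setI.
pose MNK := submodule_add NK M.
have sMNK : submodule MNK by exact: submodule_add_closed.
have MMNK : M `<=` MNK by exact: sub_submodule_addr.
have MNKN : MNK `<=` N by apply: submodule_add_sub => // u [].
have f1 : finite_length M MNK.
  exact: (@finite_length_sub _ _ M _ _ N).
have f2 : finite_length MNK N.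
  exact: (@finite_length_sub _ _ M _ _ N).
have fMNK : f @` MNK = f @` M.
  apply/seteqP; split=> [_ [_ [u [_ fu] [v Mv <-]] <-]|_ [u Mu <-]].
    by exists v; rewrite // fD fu add0r.
  by exists u => //; apply: MMNK.
have NKM : NK `&` M = M `&` linear_kernel.
  apply/seteqP; split=> u; first by move=> [[]].
  by move=> [Mu ?]; split=> //; split=> //; apply: MN.
have [|f1' e1] := @finite_length_iff V V M MNK (M `&` linear_kernel) NK _ f1.
  by move=> l; rewrite -NKM; apply: iff_sym; apply: is_length_second_iso.
have [|f2' e2] := @finite_length_iff V V' MNK N (f @` MNK) (f @` N) _ f2.
  move=> l; apply: is_length_image => //; exact: sub_submodule_addl.
split=> //; first by rewrite -fMNK.
by rewrite (@length_quo_add _ _ M MNK N) // e1 e2 fMNK.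
Qed.

End LengthLinear.

(** * Noetherian local rings *)

Section AscendingChains.
Context {R : comNzRingType}.

Definition ascending_chain_condition (V : lmodType R) : Prop :=
  forall c : nat -> set V, (forall s, submodule (c s)) ->
    (forall s, c s `<=` c s.+1) ->
    exists s0, forall s, (s0 <= s)%N -> c s `<=` c s0.

Lemma ascending_subset T (c : nat -> set T) : (forall s, c s `<=` c s.+1) ->
  forall s t, (s <= t)%N -> c s `<=` c t.
Proof.
move=> cS s t /subnK <-; elim: (t - s)%N => [//|k IHk] x /IHk; exact: cS.
Qed.

Lemma sub_ideal_span (G : set R) : G `<=` ideal_span G.
Proof. exact: sub_smallest. Qed.

Lemma ideal_span_sub (G J : set R) : ideal J -> G `<=` J -> ideal_span G `<=` J.
Proof. exact: smallest_sub. Qed.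

Lemma noetherian_acc : noetherian R -> ascending_chain_condition R^o.
Proof.
move=> noeR c csub cS; have cmono := ascending_subset cS.
have [|s sE] := noeR [set a | exists k, c k a].
  split=> [|u v [k ku] [l lv]|a u [k ku]].
  - by exists 0%N; apply: submodule0.
  - exists (maxn k l); apply: submoduleD => //.
      by apply: cmono ku; apply: leq_maxl.
    by apply: cmono lv; apply: leq_maxr.
  - by exists k; apply: submoduleZ.
have : [set` s] `<=` [set a | exists k, c k a].
  by rewrite sE; apply: sub_ideal_span.
have [s0 ss0] : exists s0, [set` s] `<=` c s0.
  have : forall a, a \in s -> exists k, c k a.
    by move=> a sa; have := @sub_ideal_span [set` s] a sa; rewrite -sE.
  elim: (s) => [|a r IHr] h; first by exists 0%N.
  have [k rk] := IHr (fun b rb => h b (mem_behead (s := a :: r) rb)).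
  have [l la] := h a (mem_head _ _).
  exists (maxn k l) => b /=; rewrite inE => /orP[/eqP->|rb].
    by apply: cmono la; apply: leq_maxr.
  by apply: cmono (rk b rb); apply: leq_maxl.
move=> _; exists s0 => t _ a ta.
have : [set a | exists k, c k a] a by exists t.
rewrite sE; exact: (ideal_span_sub (csub s0) ss0).
Qed.

(** Every counterexample has a strictly larger one; iterating a choice function for these would give
    a chain that never becomes stationary. *)
Lemma acc_induction (V : lmodType R) (P : set V -> Prop) :
  ascending_chain_condition V ->
  (forall A, submodule A -> (forall B, submodule B -> A `<` B -> P B) -> P A) ->
  forall A, submodule A -> P A.
Proof.
move=> accV IH A sA; apply: contrapT => nPA.
pose bad := {B : set V | submodule B /\ ~ P B}.
have next (B : bad) : exists C : bad, sval B `<` sval C.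
  case: B => B [sB nPB] /=; apply: contrapT => noC; apply: nPB; apply: IH => //.
  move=> C sC BC; apply: contrapT => nPC; apply: noC.
  by exists (exist _ C (conj sC nPC)).
have [f fP] := choice next.
pose c := fun s => sval (iter s f (exist _ A (conj sA nPA) : bad)).
have [s|s|s0 /(_ s0.+1 (leqnSn _))] := accV c.
- by rewrite /c; case: (iter _ _ _) => B [].
- exact: properW (fP (iter s f _)).
- by move=> h; exact: ((fP (iter s0 f _)).2 h).
Qed.

End AscendingChains.

(** * Ideals of finite colength *)

Section FiniteColength.
Context {R : comNzRingType}.
Implicit Types (m Q : set R).

(** Starting from g = 1, treat the members of s one by one: replace g by a^k g, with k the last
    exponent for which this stays outside Q. Earlier members still send the new g into Q. *)
Lemma exists_socle (Q : set R) (s : seq R) : ideal Q -> ~ Q 1 ->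
  (forall a, a \in s -> exists k : nat, Q (a ^+ k)) ->
  exists2 g, ~ Q g & forall a, a \in s -> Q (a * g).
Proof.
move=> iQ nQ1; elim: s => [|a s IHs] h; first by exists 1.
have [b sb|g nQg Qg] := IHs; first by apply: h; rewrite inE sb orbT.
have [K QaK] := h a (mem_head _ _).
have ex : exists k, `[< Q (a ^+ k * g) >].
  by exists K; apply/asboolP; rewrite mulrC; apply: (submoduleZ (V := R^o)).
case: (ex_minnP ex) => -[|k] /asboolP QK Kmin.
  by rewrite expr0 mul1r in QK.
exists (a ^+ k * g) => [/asboolP/Kmin|b]; first by rewrite ltnn.
rewrite inE => /orP[/eqP->|/Qg Qbg]; first by rewrite mulrA -exprS.
by rewrite mulrCA; apply: (submoduleZ (V := R^o)).
Qed.

Definition principal_ideal g : set R := [set a * g | a in setT].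

Lemma submodule_principal_ideal g : submodule (principal_ideal g : set R^o).
Proof.
split=> [|_ _ [a _ <-] [b _ <-]|a _ [b _ <-]].
- by exists 0; rewrite // mul0r.
- by exists (a + b); rewrite // mulrDl.
- by exists (a * b); rewrite // -mulrA.
Qed.

Lemma mem_principal_ideal g : principal_ideal g g.
Proof. by exists 1; rewrite // mul1r. Qed.

(** (Q + Rg)/Q is a quotient of the simple module R/m, so chains have length at most 1. *)
Lemma finite_length_socle m Q g : maximal_ideal m -> ideal Q ->
  (forall a, m a -> Q (a * g)) ->
  finite_length (Q : set R^o) (submodule_add (Q : set R^o) (principal_ideal g)).
Proof.
move=> [im _ mmax] iQ mgQ; set Qg := submodule_add _ _.
have sRg := submodule_principal_ideal g.
have sQg : submodule Qg by exact: submodule_add_closed.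
have simple (X : set R^o) : submodule X -> (Q : set R^o) `<` X -> X `<=` Qg -> Qg `<=` X.
  move=> sX [QX XQ] XQg.
  have [x Xx nQx] : exists2 x, X x & ~ Q x.
    apply: contrapT => h; apply: XQ => x Xx; apply: contrapT => nQx.
    by apply: h; exists x.
  have [q Qq [_ [a _ <-] xE]] := XQg x Xx.
  have nma : ~ m a.
    by move=> /mgQ Qag; apply: nQx; rewrite -xE; apply: (submoduleD iQ).
  have [||mE|mT] := mmax (submodule_add (m : set R^o) (principal_ideal a)).
  - apply: submodule_add_closed => //; exact: submodule_principal_ideal.
  - exact: (@sub_submodule_addl _ R^o m _ (submodule_principal_ideal a)).
  - case: nma; rewrite -mE; exists 0; first exact: submodule0 im.
    by exists a; rewrite ?add0r //; apply: mem_principal_ideal.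
  (* Here x = q + a g with a outside m, so 1 = u + r a for some u in m. Then g = u g + r (a g) lies
     in X, as u g is in Q and a g = x - q. *)
  have [u mu [_ [r _ <-] ura]] :
      submodule_add (m : set R^o) (principal_ideal a) 1 by rewrite mT.
  have Xg : X g.
    rewrite -[g]mul1r -ura mulrDl; apply: (submoduleD sX).
      by apply/QX/mgQ.
    rewrite -mulrA; apply: (submoduleZ r sX).
    have -> : a * g = x - q by rewrite -xE addrAC subrr add0r.
    by apply: (submoduleB sX) => //; apply: QX.
  by apply: submodule_add_sub => // _ [b _ <-]; apply: (submoduleZ b sX).
apply: (@chain_bounded_finite _ _ _ _ 1) => //; first exact: sub_submodule_addl.
case=> [|[|l]] // /chainableS[X [/chainableS[Y [QY YX sX]] [XQg QgX] _]].
case: QgX; apply: simple => //; split=> [u|XQ].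
  by move=> /(chainable_sub QY)/(properW YX).
by case: YX => _; apply => u /XQ /(chainable_sub QY).
Qed.

(** Noetherian induction on Q: a proper Q is enlarged by a socle element, at the cost of a finite
    length. *)
Lemma finite_colength m Q : noetherian R -> maximal_ideal m -> ideal Q ->
  (forall a, m a -> exists k : nat, Q (a ^+ k)) ->
  finite_length (Q : set R^o) (setT : set R^o).
Proof.
move=> noeR mmax iQ; have [s mE] : exists s : seq R, m = ideal_span [set` s].
  by apply: noeR; case: mmax.
have sT : submodule (setT : set R^o) by [].
move: Q iQ; refine (@acc_induction R R^o (fun Q : set R^o =>
  (forall a : R, m a -> exists k : nat, Q (a ^+ k)) -> finite_length Q (setT : set R^o))
  (noetherian_acc noeR) _).
move=> Q iQ IH mQ; have [Q1|nQ1] := pselect (Q 1).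
  exists 0%N; rewrite (_ : setT = (Q : set R^o)); first exact: is_lengthxx.
  apply/seteqP; split=> // a _.
  by rewrite -[a]mulr1; apply: (submoduleZ a iQ).
have [a sa|g nQg sgQ] := @exists_socle Q s iQ nQ1.
  by apply: mQ; rewrite mE; apply: sub_ideal_span.
have mgQ a : m a -> Q (a * g).
  rewrite mE; apply: (@ideal_span_sub _ _ [set a | Q (a * g)]) => //.
  split=> [|u v Qu Qv|b u Qu].
  - by rewrite /= mul0r; apply: (submodule0 iQ).
  - by rewrite /= mulrDl; apply: (submoduleD iQ).
  - by rewrite /= -mulrA; apply: (submoduleZ b iQ).
have fQ := finite_length_socle mmax iQ mgQ.
set Q' := submodule_add _ _ in fQ.
have sQ' : submodule Q' by case: fQ => l [[c /(fun h => chainable_submodule (ex_intro _ c h))[]]].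
have sRg := submodule_principal_ideal g.
apply: finite_length_add fQ _; apply: IH => //; last first.
  move=> a /mQ[k Qk]; exists k; exact: sub_submodule_addl Qk.
split; first exact: sub_submodule_addl.
move=> Q'Q; apply: nQg; apply: Q'Q; exists 0; first exact: submodule0 iQ.
by exists g; rewrite ?add0r //; apply: mem_principal_ideal.
Qed.

End FiniteColength.

(** * The Artin-Rees lemma *)

Section FunctionModules.
Context {R : comNzRingType} {T : finType}.
Local Notation V := {ffun T -> R^o}.

(** The entries at t of the members of W that vanish beyond t, in the order given by [enum_rank].
    These ideals play the role of leading coefficients and reduce chains in a free module to chains
    of ideals. *)
Definition leading_coefs (W : set V) (t : T) : set R^o :=
  [set a | exists2 u, W u & u t = a /\
     forall t', (enum_rank t < enum_rank t')%N -> u t' = 0].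

Lemma submodule_leading_coefs W t : submodule W -> submodule (leading_coefs W t).
Proof.
move=> sW; split=> [|_ _ [u Wu [<- u0]] [v Wv [<- v0]]|a _ [u Wu [<- u0]]].
- exists 0; first exact: submodule0.
  by split=> [|t' _]; rewrite ffunE.
- exists (u + v); first exact: submoduleD.
  by split=> [|t' tt']; rewrite ffunE // u0 // v0 // addr0.
- exists (a *: u); first exact: submoduleZ.
  by split=> [|t' tt']; rewrite ffunE // u0 // scaler0.
Qed.

Lemma leading_coefs_sub (W W' : set V) : submodule W -> submodule W' ->
  W' `<=` W -> (forall t, leading_coefs W t `<=` leading_coefs W' t) ->
  W `<=` W'.
Proof.
move=> sW sW' W'W lcWW'.
(* Induction on the number k of leading positions where u may be nonzero: a member of [W'] with the
   same last entry is subtracted. *)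
have h k u : W u -> (forall t, (k <= enum_rank t)%N -> u t = 0) -> W' u.
  elim: k u => [|k IHk] u Wu u0.
    rewrite (_ : u = 0); first exact: submodule0.
    by apply/ffunP => t; rewrite u0 // ffunE.
  have [[t kt]|nk] := pselect (exists t : T, nat_of_ord (enum_rank t) = k); last first.
    apply: IHk => // t kt; apply: u0; rewrite ltn_neqAle kt andbT.
    by apply/eqP => kE; apply: nk; exists t.
  have [|v W'v [vt v0]] := lcWW' t (u t).
    by exists u => //; split=> // t'; rewrite kt => /u0.
  rewrite -(subrK v u); apply: submoduleD => //; apply: IHk.
    by apply: submoduleB => //; apply: W'W.
  move=> t' kt'; rewrite !ffunE; have [tt'|tt'] := eqVneq t t'.
    by rewrite -tt' vt subrr.
  have {}kt' : (k < enum_rank t')%N.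
    rewrite ltn_neqAle kt' andbT -kt; apply: contra tt' => /eqP h.
    by apply/eqP/enum_rank_inj/val_inj.
  by rewrite u0 // v0 ?kt // subr0.
move=> u Wu; apply: (h #|T|) => // t.
by rewrite leqNgt ltn_ord.
Qed.

Lemma acc_ffun :
  ascending_chain_condition R^o -> ascending_chain_condition V.
Proof.
move=> accR c csub cS; have cmono := ascending_subset cS.
have /choice[s sP] t : exists s0, forall s, (s0 <= s)%N ->
    leading_coefs (c s) t `<=` leading_coefs (c s0) t.
  apply: (accR (fun s => leading_coefs (c s) t)) => [s|s a [u cu ut]].
    exact: submodule_leading_coefs.
  by exists u => //; apply: cS.
exists (\max_t s t)%N => k sk; apply: leading_coefs_sub => //; first exact: cmono.
move=> t a; have st : (s t <= \max_t s t)%N by exact: leq_bigmax.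
move=> /(sP t k (leq_trans st sk))[u cu ua].
by exists u => //; apply: cmono cu.
Qed.

End FunctionModules.

(** * Hilbert's basis theorem for graded families, and Artin-Rees *)

Section GradedHilbertBasis.
Context {R : comNzRingType} {V : lmodType R}.
Implicit Types (X : seq R) (E W Y : int -> set V).

(** A graded module over the polynomial ring with one variable of degree 1 for each entry of X. The
    pieces all lie in V, and the variable of a acts as multiplication by a. *)
Definition graded X W := (forall n, submodule (W n)) /\
  forall n a u, a \in X -> W n u -> W (n + 1) (a *: u).

Definition graded_acc X E := forall W : nat -> int -> set V,
  (forall s, graded X (W s)) -> (forall s n, W s n `<=` W s.+1 n) ->
  (forall s n, W s n `<=` E n) ->
  exists s0, forall s n, (s0 <= s)%N -> W s n `<=` W s0 n.

(* For indeterminate [t] of degree 1 in place of [a], this would be the part of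
   degree [n] in [E[t]], of degree less than [k] in [t]. *)
Fixpoint adjoin_lt (a : R) E (k : nat) (n : int) : set V :=
  if k is k'.+1
  then submodule_add (adjoin_lt a E k' n) [set a ^+ k' *: g | g in E (n - k'%:Z)]
  else [set 0].

Definition adjoin a E n : set V := [set u | exists k, adjoin_lt a E k n u].

Lemma graded_adjoin_step X a E n k : graded X E ->
  submodule [set a ^+ k *: g | g in E (n - k%:Z)].
Proof.
move=> [sE _]; split=> [|_ _ [u Eu <-] [v Ev <-]|b _ [u Eu <-]].
- by exists 0; [exact: submodule0|exact: scaler0].
- by exists (u + v); [exact: submoduleD|exact: scalerDr].
- exists (b *: u); first exact: submoduleZ.
  by rewrite !scalerA mulrC.
Qed.

Lemma submodule_adjoin_lt X a E k n : graded X E -> submodule (adjoin_lt a E k n).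
Proof.
move=> gE; elim: k => [|k IHk] /=; first exact: submodule_set0.
by apply: submodule_add_closed => //; apply: graded_adjoin_step gE.
Qed.

Lemma adjoin_ltS X a E k n : graded X E ->
  adjoin_lt a E k n `<=` adjoin_lt a E k.+1 n.
Proof.
by move=> gE; apply: sub_submodule_addl; apply: graded_adjoin_step gE.
Qed.

Lemma adjoin_lt_scale X a b E k n u : graded X E -> b \in X ->
  adjoin_lt a E k n u -> adjoin_lt a E k (n + 1) (b *: u).
Proof.
move=> [sE gE] bX; elim: k u => [|k IHk] u /=; first by move=> ->; exact: scaler0.
move=> [v /IHk Ev [_ [g Eg <-] <-]]; exists (b *: v) => //.
exists (a ^+ k *: (b *: g)); last by rewrite scalerDr !scalerA mulrC.
by exists (b *: g) => //; rewrite addrAC; apply: gE.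
Qed.

Lemma adjoin_lt_shift X a E k n u : graded X E ->
  adjoin_lt a E k n u -> adjoin_lt a E k.+1 (n + 1) (a *: u).
Proof.
move=> gE; elim: k u => [|k IHk] u.
  move=> /= ->; rewrite scaler0; apply: submodule0; exact: (submodule_adjoin_lt a 1 _ gE).
move=> [v /IHk Ev [_ [g Eg <-] <-]]; exists (a *: v) => //.
exists (a ^+ k.+1 *: g); last by rewrite scalerDr !scalerA -exprS.
by exists g => //; rewrite (_ : n + 1 - k.+1%:Z = n - k%:Z) //; lia.
Qed.

Lemma graded_adjoin X a E : graded X E -> graded (a :: X) (adjoin a E).
Proof.
move=> gE; have sD k n := submodule_adjoin_lt a k n gE.
have mono n k l : (k <= l)%N -> adjoin_lt a E k n `<=` adjoin_lt a E l n.
  by apply: (@ascending_subset _ (fun k => adjoin_lt a E k n)) => j; exact: adjoin_ltS gE.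
split=> [n|n b u].
  split=> [|u v [k Du] [l Dv]|b u [k Du]].
  - by exists 0%N.
  - exists (maxn k l); apply: submoduleD => //.
      by apply: mono Du; apply: leq_maxl.
    by apply: mono Dv; apply: leq_maxr.
  - by exists k; apply: submoduleZ.
rewrite inE => /orP[/eqP->|bX] [k Du].
  by exists k.+1; apply: adjoin_lt_shift gE _.
by exists k; apply: adjoin_lt_scale gE _ _.
Qed.

Lemma sub_adjoin X a E n : graded X E -> E n `<=` adjoin a E n.
Proof.
move=> [sE _] u Eu; exists 1%N; exists 0 => //; exists u; last by rewrite add0r.
by exists u; rewrite ?subr0 // expr0 scale1r.
Qed.

(* [a ^+ k *: g + (terms of degree < k in a)] has leading coefficient [g]. *)
Definition adjoin_lead a E W k n : set V :=
  [set g | E n g /\ exists2 e, adjoin_lt a E k (n + k%:Z) e &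
     W (n + k%:Z) (e + a ^+ k *: g)].

Lemma graded_adjoin_lead X a E W k : graded X E -> graded (a :: X) W ->
  graded X (adjoin_lead a E W k).
Proof.
move=> gE [sW gW]; have sD k' n := submodule_adjoin_lt a k' n gE.
have [sE sgE] := gE; split=> [n|n b g bX [Eg [e De We]]].
  split=> [|g g' [Eg [e De We]] [Eg' [e' De' We']]|b g [Eg [e De We]]].
  - split; first exact: submodule0.
    exists 0; first exact: submodule0.
    by rewrite scaler0 addr0; apply: submodule0.
  - split; first exact: submoduleD.
    exists (e + e'); first exact: submoduleD.
    by rewrite scalerDr addrACA; apply: submoduleD.
  - split; first exact: submoduleZ.
    exists (b *: e); first exact: submoduleZ.
    by rewrite scalerA mulrC -scalerA -scalerDr; apply: submoduleZ.
split; first exact: sgE.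
exists (b *: e); rewrite addrAC; first exact: adjoin_lt_scale gE _ _.
rewrite scalerA mulrC -scalerA -scalerDr; apply: gW => //.
by rewrite inE bX orbT.
Qed.

Lemma adjoin_leadS X a E W k n : graded X E -> graded (a :: X) W ->
  adjoin_lead a E W k n `<=` adjoin_lead a E W k.+1 n.
Proof.
move=> gE [sW gW] g [Eg [e De We]]; split=> //.
have -> : n + k.+1%:Z = n + k%:Z + 1 by lia.
exists (a *: e); first exact: adjoin_lt_shift gE _.
by rewrite exprS -scalerA -scalerDr; apply: gW; rewrite ?mem_head.
Qed.

(** Induction on the length k of an expression in powers of a: an element of W with the same top
    coefficient is subtracted, which leaves an element of [W'] with a shorter expression. *)
Lemma adjoin_lead_sub X a E W W' : graded X E ->
  graded (a :: X) W -> graded (a :: X) W' ->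
  (forall n, W n `<=` W' n) -> (forall n, W' n `<=` adjoin a E n) ->
  (forall k n, adjoin_lead a E W' k n `<=` adjoin_lead a E W k n) ->
  forall n, W' n `<=` W n.
Proof.
move=> gE [sW gW] [sW' gW'] WW' W'E lead n u W'u.
have [k Du] := W'E n u W'u; elim: k u W'u Du => [|k IHk] u W'u Du.
  by rewrite Du; apply: submodule0.
have [e De [_ [g Eg <-] uE]] := Du.
have [|_ [e' De' We']] := lead k (n - k%:Z) g.
  by split=> //; exists e; rewrite subrK // uE.
rewrite subrK in De' We'.
rewrite -uE -(subrK e' e) -addrA; apply: submoduleD => //; apply: IHk.
  have -> : e - e' = u - (e' + a ^+ k *: g) by rewrite -uE opprD addrACA subrr addr0.
  by apply: submoduleB => //; apply: WW'.
by apply: submoduleB => //; apply: submodule_adjoin_lt gE.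
Qed.

(* Hilbert's basis theorem: the leading coefficients [L s k] are stationary along
   the diagonal [k = s], and for each of the finitely many smaller [k]. *)
Lemma graded_acc_adjoin X a E : graded X E -> graded_acc X E ->
  graded_acc (a :: X) (adjoin a E).
Proof.
move=> gE accE W gW WS WE; have Wmono n := @ascending_subset _ (W ^~ n) (WS ^~ n).
pose L s k := adjoin_lead a E (W s) k.
have gL s k : graded X (L s k) by exact: graded_adjoin_lead.
have LE s k n : L s k n `<=` E n by move=> g [].
have Lk s k k' n : (k <= k')%N -> L s k n `<=` L s k' n.
  by apply: (@ascending_subset _ (fun k => L s k n)) => j; apply: adjoin_leadS gE _.
have Ls s s' k n : (s <= s')%N -> L s k n `<=` L s' k n.
  by move=> ss' g [Eg [e De We]]; split=> //; exists e => //; apply: Wmono We.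
have [s0 s0P] : exists s0, forall s n, (s0 <= s)%N -> L s s n `<=` L s0 s0 n.
  apply: accE => // s n g Lg; apply: Ls (leqnSn s) _ _.
  exact: Lk (leqnSn s) _ _.
have /choice[t tP] k : exists t, forall s n, (t <= s)%N -> L s k n `<=` L t k n.
  by apply: (accE (fun s => L s k)) => // s n; apply: Ls.
pose s1 := maxn s0 (\max_(k < s0) t k).
have s01 : (s0 <= s1)%N by exact: leq_maxl.
exists s1 => s n s1s; apply: (adjoin_lead_sub gE) => // [k|k j g Lg].
  exact: Wmono.
have [ks0|s0k] := ltnP k s0.
  have tk : (t k <= s1)%N.
    apply: leq_trans (leq_maxr _ _).
    exact: (leq_bigmax (Ordinal ks0)).
  exact: Ls tk _ (tP k s j (leq_trans tk s1s) _ Lg).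
apply: (Ls _ _ _ _ s01); apply: (Lk _ _ _ _ s0k).
apply: (s0P (maxn s k)); first by apply: leq_trans s01 (leq_trans s1s (leq_maxl _ _)).
by apply: Ls (leq_maxl _ _) _ _; apply: Lk (leq_maxr _ _) _ _.
Qed.

(** Begin with A concentrated in degree [n0], where chains are chains of submodules of V, and adjoin
    the members of X in turn. *)
Lemma graded_acc_cover X (A : set V) n0 : ascending_chain_condition V ->
  submodule A -> exists E, [/\ graded X E, graded_acc X E & A `<=` E n0].
Proof.
move=> accV sA; elim: X => [|a X [E [gE accE AE]]].
  exists (fun n => if n == n0 then A else [set 0]); split; last by rewrite eqxx.
  - by split=> // n; case: eqP => // _; apply: submodule_set0.
  - move=> W gW WS WE.
    have [s|s|s0 s0P] := accV (W ^~ n0); first by case: (gW s).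
      exact: WS.
    exists s0 => s n s0s; have [->|nn0] := eqVneq n n0; first exact: s0P.
    move=> u /WE; rewrite (negbTE nn0) => ->; apply: submodule0; exact: (gW s0).1.
exists (adjoin a E); split; first exact: graded_adjoin.
  exact: graded_acc_adjoin.
by move=> u /AE; exact: (sub_adjoin a gE).
Qed.

Definition scaled_sum d (x : 'I_d -> R) (A : set V) : set V :=
  [set u | exists v : 'I_d -> V, (forall j, A (v j)) /\ u = \sum_j x j *: v j].

Lemma submodule_scaled_sum d (x : 'I_d -> R) (A : set V) :
  submodule A -> submodule (scaled_sum x A).
Proof.
move=> sA; split=> [|_ _ [u [Au ->]] [v [Av ->]]|a _ [u [Au ->]]].
- exists (fun=> 0); split=> [j|]; first exact: submodule0.
  by rewrite big1 // => j _; rewrite scaler0.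
- exists (fun j => u j + v j); split=> [j|]; first exact: submoduleD.
  by rewrite -big_split; apply: eq_bigr => j _; rewrite scalerDr.
- exists (fun j => a *: u j); split=> [j|]; first exact: submoduleZ.
  by rewrite scaler_sumr; apply: eq_bigr => j _; rewrite !scalerA mulrC.
Qed.

Lemma mem_scaled_sum d (x : 'I_d -> R) (A : set V) j u :
  submodule A -> A u -> scaled_sum x A (x j *: u).
Proof.
move=> sA Au; exists (fun i => if i == j then u else 0); split=> [i|].
  by case: eqP => // _; apply: submodule0.
rewrite (bigD1 j) //= eqxx big1 ?addr0 // => i /negbTE->; exact: scaler0.
Qed.

(** From degree [n0] on, F is generated by its piece of degree [n0], so it lies in a family E with
    the chain condition. The submodules generated by the pieces of Z of degree at most s thus
    stabilise at some [s0], and beyond it new elements are combinations of the x_j with coefficients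
    in the preceding piece. *)
Lemma artin_rees d (x : 'I_d -> R) (F Z : int -> set V) (n0 : int) :
  ascending_chain_condition V ->
  (forall n, submodule (F n)) ->
  (forall n : int, n0 <= n -> F (n + 1) `<=` scaled_sum x (F n)) ->
  graded (codom x) Z -> (forall n, Z n `<=` F n) ->
  exists N : int, forall n : int, N <= n -> Z (n + 1) `<=` scaled_sum x (Z n).
Proof.
move=> accV sF FS [sZ gZ] ZF.
have [E [[sE gE] accE FE]] := graded_acc_cover (codom x) n0 accV (sF n0).
have {}FE (n : int) : n0 <= n -> F n `<=` E n.
  move=> n0n; have -> : n = n0 + `|n - n0|%N%:Z by lia.
  elim: `|_|%N => [|k IHk]; first by rewrite addr0.
  have -> : n0 + k.+1%:Z = n0 + k%:Z + 1 by lia.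
  move=> u /FS[|v [Fv ->]]; first by lia.
  apply: submodule_sum => // j _; apply: gE; first exact: codom_f.
  exact: IHk.
(* Below [n0] nothing places F inside E, so Z is cut off there. *)
pose Z0 (n : int) : set V := if n0 <= n then Z n else [set 0].
have gZ0 : graded (codom x) Z0.
  split=> [n|n a u ax]; rewrite /Z0; first by case: ifP => // _; exact: submodule_set0.
  case: ifP => [n0n|_ ->]; last by rewrite scaler0; case: ifP => // _; apply: submodule0.
  rewrite (_ : n0 <= n + 1); last by lia.
  exact: gZ.
have [sZ0 gZ0'] := gZ0.
have Z0E n : Z0 n `<=` E n.
  rewrite /Z0; case: ifP => [n0n u /ZF|_ u ->]; first exact: FE.
  exact: submodule0.
(* [W s] is the graded submodule generated by the [Z0 n], for [n <= s]. *)
pose above s Y := graded (codom x) Y /\ forall n : int, n <= s%:Z -> Z0 n `<=` Y n.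
pose W s n : set V := [set u | forall Y, above s Y -> Y n u].
have [s|s n u Wu Y [gY YP]|s n u|s0 s0P] := accE W.
- split=> [n|n a u ax Wu Y hY]; last by case: (hY) => -[_ gY] _; apply: gY => //; apply: Wu.
  split=> [Y [[sY _] _]|u v Wu Wv Y hY|a u Wu Y hY]; first exact: submodule0.
    by case: (hY) => -[sY _] _; apply: submoduleD => //; [apply: Wu|apply: Wv].
  by case: (hY) => -[sY _] _; apply: submoduleZ => //; apply: Wu.
- by apply: Wu; split=> // k ks; apply: YP; lia.
- by move=> Wu; apply: Z0E; apply: Wu; split=> // k _.
exists (Order.max n0 s0%:Z) => n; rewrite ge_max => /andP[n0n s0n] u Zu.
(* A graded family with all generators up to degree [s0 <= n], hence containing [W s0], and by
   design equal to the sum of the x_j Z(n) in degree n + 1. *)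
pose Y (k : int) : set V := if k <= n then Z0 k else scaled_sum x (Z0 (k - 1)).
have Z0n : Z0 n = Z n by rewrite /Z0 n0n.
have : Y (n + 1) u.
  apply: (s0P (absz (n + 1)) (n + 1) _ u _ Y); first lia.
    move=> Y' [_]; apply; first lia.
    by rewrite /Z0 (_ : n0 <= n + 1) //; lia.
  split; last by move=> k ks; rewrite /Y (_ : k <= n) //; lia.
  split=> [k|k _ v /codomP[j ->]]; rewrite /Y.
    by case: ifP => // _; apply: submodule_scaled_sum.
  have [kn1|nk1] := boolP (k + 1 <= n).
    rewrite (_ : k <= n); last by lia.
    move=> Zv; apply: gZ0' => //; exact: codom_f.
  rewrite addrK; case: ifP => [kn|nkn]; first exact: mem_scaled_sum.
  move=> [w [Zw ->]]; apply: mem_scaled_sum => //; apply: submodule_sum => // i _.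
  rewrite -(subrK 1 k); apply: gZ0'; [exact: codom_f|exact: Zw].
by rewrite /Y (_ : (n + 1 <= n) = false) ?addrK ?Z0n //; lia.
Qed.

End GradedHilbertBasis.

(** * Koszul complexes *)

Section KoszulAlgebra.
Context {R : comNzRingType} {d : nat}.
Variable x : 'I_d -> R.
Local Notation koszul := (@koszul R d).
Implicit Types (u v : koszul) (S T : {set 'I_d}) (j k : 'I_d).

Definition koszul_index j T := #|[pred k in T | (k < j)%N]|.

Lemma koszul_diffE u T :
  koszul_diff x u T =
  \sum_(j | j \notin T) (-1) ^+ koszul_index j T * x j * u (j |: T)%SET.
Proof. by rewrite ffunE. Qed.

Lemma koszul_diff_linear : linear (koszul_diff x).
Proof.
move=> a u v; apply/ffunP => T; rewrite !ffunE /GRing.scale /= mulr_sumr -big_split /=.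
by apply: eq_bigr => j _; rewrite !ffunE /GRing.scale /= mulrDr mulrCA.
Qed.

Lemma koszul_diff0 : koszul_diff x 0 = 0.
Proof.
by apply/ffunP => T; rewrite !ffunE big1 // => j _; rewrite ffunE mulr0.
Qed.

Lemma koszul_indexU j k T : k \notin T ->
  koszul_index j (k |: T)%SET = ((k < j) + koszul_index j T)%N.
Proof.
move=> kT; rewrite /koszul_index (cardD1 k) !inE eqxx /=; congr (_ + _)%N.
apply: eq_card => i; rewrite !inE; have [->|//] := eqVneq i k.
by rewrite (negbTE kT).
Qed.

Lemma signr_ltn j k : j != k ->
  (-1) ^+ (j < k)%N = - (-1) ^+ (k < j)%N :> R.
Proof.
by rewrite -val_eqE /=; case: ltngtP => // _ _; rewrite ?expr0 ?expr1 ?opprK.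
Qed.

(** The terms at (j,k) and (k,j) are cancelled in pairs; deducing that the sum is its own opposite
    would not be enough, as 2 may be a zero divisor. *)
Lemma sum_antisymmetric (P : pred 'I_d) (G : 'I_d -> 'I_d -> R) :
  (forall j k, P j -> P k -> j != k -> G j k = - G k j) ->
  \sum_(j | P j) \sum_(k | P k && (k != j)) G j k = 0.
Proof.
move=> Ganti.
rewrite (eq_bigr (fun j => \sum_(k | P k && (j < k)%N) G j k +
                           \sum_(k | P k && (k < j)%N) G j k)); last first.
  move=> j Pj; rewrite (bigID (fun k : 'I_d => (j < k)%N)) /=.
  by congr (_ + _); apply: eq_bigl => k; rewrite -andbA -val_eqE /=;
     case: ltngtP; rewrite ?andbF.
rewrite big_split /= [X in _ + X](exchange_big_dep P) /=; last by move=> j k _ /andP[].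
rewrite -big_split big1 //= => j Pj.
rewrite [X in _ + X](eq_bigl (fun k => P k && (j < k)%N)); last by move=> k; rewrite Pj.
rewrite -big_split big1 //= => k /andP[Pk jk].
by rewrite [G k j]Ganti ?subrr // -val_eqE /=; lia.
Qed.

Lemma koszul_diff_diff u : koszul_diff x (koszul_diff x u) = 0.
Proof.
apply/ffunP => T; rewrite koszul_diffE [RHS]ffunE.
pose G j k := (-1) ^+ (koszul_index j T + koszul_index k T) * (-1) ^+ (j < k)%N *
              (x j * x k * u (j |: (k |: T))%SET) : R.
transitivity (\sum_(j | j \notin T) \sum_(k | (k \notin T) && (k != j)) G j k).
  apply: eq_bigr => j jT; rewrite koszul_diffE mulr_sumr.
  apply: eq_big => [k|k]; first by rewrite !inE negb_or andbC.
  rewrite !inE negb_or => /andP[kj kT].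
  rewrite /G koszul_indexU // !exprD finset.setUCA; ring.
apply: sum_antisymmetric => j k jT kT jk.
by rewrite /G (signr_ltn jk) finset.setUCA addnC; ring.
Qed.

(** Left multiplication by e_j in the exterior algebra. *)
Definition koszul_homotopy j u : koszul :=
  [ffun T : {set 'I_d} =>
    if j \in T then (-1) ^+ koszul_index j T * u (T :\ j)%SET else 0].

Lemma signr_mul_self n : (-1) ^+ n * (-1) ^+ n = 1 :> R.
Proof. by rewrite -exprMn mulrNN mulr1 expr1n. Qed.

(* The Cartan formula [d h_j + h_j d = x_j], on cycles. *)
Lemma koszul_homotopyP j u : koszul_diff x u = 0 ->
  koszul_diff x (koszul_homotopy j u) = x j *: u.
Proof.
move=> du; apply/ffunP => T; rewrite koszul_diffE [RHS]ffunE /GRing.scale /=.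
have [jT|jT] := boolP (j \in T); last first.
  rewrite (bigD1 j) //= big1 ?addr0 => [|k /andP[kT kj]].
    rewrite ffunE finset.setU11 koszul_indexU // ltnn add0n finset.setU1K //.
    by rewrite mulrACA signr_mul_self mul1r.
  by rewrite ffunE !inE eq_sym (negbTE kj) (negbTE jT) mulr0.
pose S := (T :\ j)%SET; have jS : j \notin S by rewrite !inE eqxx.
have TE : T = (j |: S)%SET by rewrite finset.setD1K.
have jTS : koszul_index j T = koszul_index j S by rewrite TE koszul_indexU // ltnn.
(* The coefficient of du = 0 at T \ j expresses x_j u(T) by the terms with k outside T, which are
   those of the left-hand side up to sign. *)
have : (-1) ^+ koszul_index j T * koszul_diff x u S = 0.
  by rewrite du ffunE mulr0.
rewrite koszul_diffE (bigD1 j) //= mulrDr -TE jTS mulrA mulrA signr_mul_self mul1r.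
move=> /eqP; rewrite addr_eq0 => /eqP->; rewrite mulr_sumr -sumrN.
have kTS k : (k \notin T) = (k \notin S) && (k != j).
  by rewrite !inE negb_and negbK; have [->|] := eqVneq k j; rewrite /= ?jT ?andbT.
apply: eq_big => [//|k kT]; have := kT; rewrite kTS => /andP[kS kj].
rewrite ffunE !inE jT orbT koszul_indexU // TE !koszul_indexU // ltnn.
have -> : ((k |: (j |: S)) :\ j)%SET = (k |: S)%SET.
  apply/finset.setP => i; rewrite !inE; have [->|//] := eqVneq i j.
  by rewrite /= eq_sym (negbTE kj); apply/esym/negbTE.
rewrite add0n !exprD (signr_ltn kj) -[RHS]mul1r.
by rewrite -[X in _ = X * _](signr_mul_self (j < k)%N); ring.
Qed.

End KoszulAlgebra.

(** * The subcomplexes K^(n) and their acyclicity for large n *)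

Section KoszulFiltration.
Context {R : comNzRingType} {d : nat}.
Variables (x : 'I_d -> R) (Is : int -> set R).
Local Notation koszul := (@koszul R d).
Implicit Types (u v : koszul) (S T : {set 'I_d}) (j k : 'I_d) (n : int).

Hypothesis Is_ideal : forall n, ideal (Is n).
Hypothesis Is_decr : forall n, Is (n + 1) `<=` Is n.
Hypothesis Is_scale : forall n j a, Is n a -> Is (n + 1) (x j * a).

Lemma filtration_mono (m n : int) : m <= n -> Is n `<=` Is m.
Proof.
move=> mn; rewrite (_ : n = m + (absz (n - m))%:Z); last by lia.
elim: (absz _) => [|l IHl]; first by rewrite addr0.
rewrite (_ : m + l.+1%:Z = m + l%:Z + 1); last by lia.
by move=> a /Is_decr/IHl.
Qed.

Lemma submodule_koszul_sub n i : submodule (koszul_sub Is n i : set koszul).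
Proof.
split=> [S|u v uP vP S|a u uP S].
- by rewrite ffunE; case: ifP => // _; apply: submodule0 (Is_ideal _).
- rewrite ffunE; have := uP S; have := vP S; case: ifP => _; last by move=> -> ->; rewrite addr0.
  by move=> ? ?; apply: submoduleD (Is_ideal _) _ _.
- rewrite ffunE; have := uP S; case: ifP => _; last by move=> ->; rewrite scaler0.
  by move=> ?; apply: (submoduleZ a (Is_ideal _)).
Qed.

Lemma koszul_sub_gt n i : (d < i)%N -> koszul_sub Is n i = [set (0 : koszul)].
Proof.
move=> di; apply/seteqP; split=> [u uP|_ ->]; last exact: submodule0 (submodule_koszul_sub _ _).
apply/ffunP => S; have := uP S; rewrite ffunE ltn_eqF //.
by apply: leq_ltn_trans di; rewrite -[X in (_ <= X)%N]card_ord max_card.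
Qed.

Lemma submodule_koszul_cycles n i : submodule (koszul_cycles x Is n i).
Proof.
apply: submodule_setI; first exact: submodule_koszul_sub.
exact: submodule_linear_kernel (koszul_diff_linear x).
Qed.

Lemma submodule_koszul_boundaries n i : submodule (koszul_boundaries x Is n i).
Proof.
exact: submodule_image (koszul_diff_linear x) _ (submodule_koszul_sub _ _).
Qed.

Lemma koszul_diff_sub n i u :
  koszul_sub Is n i.+1 u -> koszul_sub Is n i (koszul_diff x u).
Proof.
move=> uP T; rewrite koszul_diffE; case: ifP => [/eqP Ti|/negbT Ti].
  apply: (submodule_sum (Is_ideal _)) => j jT; rewrite -mulrA.
  apply: (submoduleZ ((-1) ^+ koszul_index j T) (Is_ideal _)).
  rewrite (_ : n - i%:Z = n - i.+1%:Z + 1); last by lia.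
  by apply: Is_scale; have := uP (j |: T)%SET; rewrite cardsU1 jT Ti eqxx.
rewrite big1 // => j jT; have := uP (j |: T)%SET.
by rewrite cardsU1 jT eqSS (negbTE Ti) => ->; rewrite mulr0.
Qed.

Lemma koszul_homotopy_sub n i j u :
  koszul_sub Is n i u -> koszul_sub Is (n + 1) i.+1 (koszul_homotopy j u).
Proof.
move=> uP T; rewrite ffunE; have [jT|jT] := boolP (j \in T); last first.
  by case: ifP => // _; apply: submodule0 (Is_ideal _).
rewrite (cardsD1 j T) jT eqSS; have := uP (T :\ j)%SET.
case: ifP => _ h; last by rewrite h mulr0.
rewrite (_ : n + 1 - i.+1%:Z = n - i%:Z); last by lia.
exact: (submoduleZ _ (Is_ideal _)).
Qed.

Lemma koszul_sub_decr n n' i : n <= n' -> koszul_sub Is n' i `<=` (koszul_sub Is n i : set koszul).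
Proof.
move=> nn' u uP S; have := uP S; case: ifP => // _; apply: filtration_mono; lia.
Qed.

Lemma koszul_boundaries_cycles n i :
  koszul_boundaries x Is n i `<=` koszul_cycles x Is n i.
Proof.
move=> _ [u uP <-]; split; [exact: koszul_diff_sub|exact: koszul_diff_diff].
Qed.

Lemma koszul_sub_scaled_sum n i :
  Is (n - i%:Z + 1) `<=` scaled_sum x (Is (n - i%:Z) : set R^o) ->
  koszul_sub Is (n + 1) i `<=` scaled_sum x (koszul_sub Is n i : set koszul).
Proof.
move=> IsS u uP.
have /choice[w wP] S : exists w : 'I_d -> R^o, (forall j,
    if #|S| == i then Is (n - i%:Z) (w j) else w j = 0) /\ u S = \sum_j x j *: w j.
  have := uP S; case: ifP => _.
    by rewrite addrAC => /IsS[w [Iw ->]]; exists w.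
  by move=> ->; exists (fun=> 0); split=> //; rewrite big1 // => j _; rewrite scaler0.
exists (fun j => [ffun S => w S j]); split=> [j S|].
  by rewrite ffunE; apply: (wP S).1.
apply/ffunP => S; rewrite (wP S).2 sum_ffunE; apply: eq_bigr => j _.
by rewrite !ffunE.
Qed.

Lemma koszul_acyclic (n0 : int) :
  (forall n, n0 <= n -> Is (n + 1) `<=` scaled_sum x (Is n : set R^o)) ->
  ascending_chain_condition R^o ->
  exists N : int, forall n i, N <= n -> (i <= d)%N ->
    koszul_boundaries x Is n i = koszul_cycles x Is n i.
Proof.
move=> IsS accR.
have acyc i : exists N : int, forall n, N <= n ->
    koszul_cycles x Is n i `<=` koszul_boundaries x Is n i.
  (* The threshold moves by i because the term of degree i is built from I_(n-i). *)
  have [//|n|n nn0||n u []//|N NP] := @artin_rees R koszul d x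
      (fun n => koszul_sub Is n i) (fun n => koszul_cycles x Is n i) (n0 + i%:Z).
  - exact: acc_ffun.
  - exact: submodule_koszul_sub.
  - by apply: koszul_sub_scaled_sum; apply: IsS; lia.
  - split=> [n|n _ u /codomP[j ->] [uP du]]; first exact: submodule_koszul_cycles.
    rewrite /koszul_cycles /= -(koszul_homotopyP j du) koszul_diff_diff; split=> //.
    by apply: koszul_diff_sub; apply: koszul_homotopy_sub.
  (* A cycle of K^(n) is a sum of x_j v_j with cycles v_j of K^(n-1), and the homotopy, raising n by
     one, makes x_j v_j a boundary in K^(n). *)
  exists (N + 1) => n Nn u; rewrite -(subrK 1 n) => /NP[|v [vP ->]]; first lia.
  apply: submodule_sum => [|j _]; first exact: submodule_koszul_boundaries.
  have [vPj dv] := vP j; rewrite -(koszul_homotopyP j dv).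
  by exists (koszul_homotopy j (v j)) => //; apply: koszul_homotopy_sub.
have /choice[N NP] := acyc.
exists (\big[Order.max/0]_(i < d.+1) N i) => n i Nn id.
apply/seteqP; split; first exact: koszul_boundaries_cycles.
apply: NP; apply: le_trans Nn; rewrite -ltnS in id.
exact: (@le_bigmax _ _ _ 0 (fun i : 'I_d.+1 => N i) (Ordinal id)).
Qed.

End KoszulFiltration.

(** * Lengths of products *)

Section ProductLength.
Context {R : comNzRingType} {T : finType}.
Local Notation V := {ffun T -> R^o}.
Implicit Types A B C : T -> set R^o.

Definition product_submodule C : set V := [set u | forall t, C t (u t)].

Lemma submodule_product C :
  (forall t, submodule (C t)) -> submodule (product_submodule C).
Proof.
move=> sC; split=> [t|u v Cu Cv t|a u Cu t]; rewrite ffunE.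
- exact: submodule0.
- exact: submoduleD.
- exact: submoduleZ.
Qed.

Lemma is_length_product A B :
  (forall t, submodule (A t)) -> (forall t, submodule (B t)) ->
  (forall t, A t `<=` B t) -> (forall t, finite_length (A t) (B t)) ->
  is_length (product_submodule A) (product_submodule B)
    (\sum_t length_quo (A t) (B t)).
Proof.
move=> sA sB AB fAB.
(* Pass from A to B one coordinate at a time; each step is measured by the projection to that
   coordinate, whose kernel is unaffected by the change. *)
pose C (r : seq T) t := if t \in r then B t else A t.
have sC r t : submodule (C r t) by rewrite /C; case: ifP.
have -> : B = C (index_enum T) by apply/funext => t; rewrite /C mem_index_enum.
have -> : (\sum_t length_quo (A t) (C (index_enum T) t) =
           \sum_(t <- index_enum T) length_quo (A t) (B t))%N.
  by apply: eq_bigr => t _; rewrite /C mem_index_enum.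
elim: (index_enum T) (index_enum_uniq T) => [_|t r IHr /= /andP[tr /IHr ACr]].
  rewrite big_nil (_ : C [::] = A); first exact/is_lengthxx/submodule_product.
  by apply/funext.
rewrite big_cons addnC; apply: is_length_add ACr _.
pose p (u : V) := u t.
have p_linear : linear p by move=> a u v; rewrite /p !ffunE.
have CC' : product_submodule (C r) `<=` product_submodule (C (t :: r)).
  move=> u Cu t'; have := Cu t'; rewrite /C inE; case: (t' \in r); first by rewrite orbT.
  by rewrite orbF; case: ifP => // _; apply: AB.
have pC r' : p @` product_submodule (C r') = C r' t.
  apply/seteqP; split=> [_ [u Cu <-]|a Ca]; first exact: Cu.
  exists [ffun t' => if t' == t then a else 0]; last by rewrite /p ffunE eqxx.
  by move=> t'; rewrite ffunE; case: eqP => [->//|_]; apply: submodule0.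
apply/(is_length_image p_linear) => //; try exact: submodule_product.
  move=> u [Cu pu] t'; have := Cu t'; rewrite /C inE.
  have [->|//] := eqVneq t' t; move=> _.
  by rewrite [u t]pu; case: ifP => _; apply: submodule0.
rewrite !pC /C mem_head (negbTE tr); exact: length_quoP.
Qed.

End ProductLength.

(** * The Euler characteristic of K^(n) in terms of the Hilbert function *)

Section KoszulEuler.
Context {R : comNzRingType} {d : nat}.
Variables (x : 'I_d -> R) (Is : int -> set R).
Local Notation koszul := (@koszul R d).
Local Notation H := (hilbert_fun Is).
Implicit Types (u v : koszul) (S T : {set 'I_d}) (j k : 'I_d).

Hypothesis Is_ideal : forall n, ideal (Is n).
Hypothesis Is_decr : forall n, Is (n + 1) `<=` Is n.
Hypothesis Is_scale : forall n j a, Is n a -> Is (n + 1) (x j * a).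
Hypothesis Is_colength : forall n, finite_length (Is n : set R^o) (setT : set R^o).

Lemma koszul_subE n i : koszul_sub Is n i =
  product_submodule (fun S : {set 'I_d} =>
    if #|S| == i then Is (n - i%:Z) : set R^o else [set 0]).
Proof.
apply/seteqP; split=> u uP S; have := uP S; case: ifP => //.
Qed.

Lemma length_filtration (m n : int) : m <= n ->
  finite_length (Is n : set R^o) (Is m : set R^o) /\
  (length_quo (Is n : set R^o) (Is m : set R^o))%:Z = (H n)%:Z - (H m)%:Z.
Proof.
move=> mn; have nm := filtration_mono Is_decr mn.
have sT : submodule (setT : set R^o) by [].
split; first exact:
  (finite_length_sub (And4 (Is_ideal _) (Is_ideal _) (Is_ideal _) sT) _ nm _
    (Is_colength n)).
by rewrite /hilbert_fun (length_quo_add (And3 (Is_ideal n) (Is_ideal m) sT)) //; lia.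
Qed.

Lemma length_koszul_sub (n N : int) i : n <= N ->
  finite_length (koszul_sub Is N i : set koszul) (koszul_sub Is n i) /\
  (length_quo (koszul_sub Is N i : set koszul) (koszul_sub Is n i))%:Z =
  'C(d, i)%:Z * ((H (N - i%:Z))%:Z - (H (n - i%:Z))%:Z).
Proof.
move=> nN; have niN : n - i%:Z <= N - i%:Z by lia.
have [fin len] := length_filtration niN.
set l := length_quo _ _ in len.
have h : is_length (koszul_sub Is N i : set koszul) (koszul_sub Is n i) ('C(d, i) * l).
  rewrite !koszul_subE; set A := fun S => _; set B := fun S => _.
  have -> : ('C(d, i) * l = \sum_S length_quo (A S) (B S))%N.
    rewrite -[d in 'C(d, i)]card_ord -card_draws -sum_nat_const [LHS]big_mkcond.
    apply: eq_bigr => S _; rewrite inE /A /B; case: ifP => // _.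
    by rewrite length_quoxx //; apply: submodule_set0.
  apply: is_length_product => S; rewrite /A /B; case: ifP => _ //;
    try exact: submodule_set0; try exact: Is_ideal.
  - exact: filtration_mono.
  - by exists 0%N; apply: is_lengthxx; apply: submodule_set0.
by split; [exists ('C(d, i) * l)%N|rewrite (length_quoE h) PoszM len].
Qed.

(** Let k_i, z_i, b_i be the lengths of the terms, cycles and boundaries of K^(n) relative to those
    of K^(N). Rank-nullity gives k_i = z_i + b_(i-1), and z_i = b_i + h_i because cycles and
    boundaries of K^(N) agree. So h_i and k_i have the same alternating sum. *)
Lemma koszul_euler_formula (n N : int) : n <= N ->
  (forall i, (i <= d)%N -> koszul_boundaries x Is N i = koszul_cycles x Is N i) ->
  (forall i, (i <= d)%N -> koszul_homology_finite x Is n i) /\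
  koszul_euler x Is n =
    \sum_(i < d.+1) (-1) ^+ i * ('C(d, i)%:Z * ((H (N - i%:Z))%:Z - (H (n - i%:Z))%:Z)).
Proof.
move=> nN acyc.
pose K i : set koszul := koszul_sub Is n i; pose L i : set koszul := koszul_sub Is N i.
have sK i : submodule (K i) by exact: submodule_koszul_sub.
have sL i : submodule (L i) by exact: submodule_koszul_sub.
have LK i : L i `<=` K i by exact: koszul_sub_decr.
have lin := koszul_diff_linear x.
have rn i := length_rank_nullity lin (sL i) (sK i) (LK i) (length_koszul_sub i nN).1.
pose k i := length_quo (L i) (K i).
pose z i := length_quo (koszul_cycles x Is N i) (koszul_cycles x Is n i).
pose b i := length_quo (koszul_boundaries x Is N i) (koszul_boundaries x Is n i).
pose h i := koszul_homology_length x Is n i.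
have sZ m i : submodule (koszul_cycles x Is m i) by exact: submodule_koszul_cycles.
have sB m i : submodule (koszul_boundaries x Is m i) by exact: submodule_koszul_boundaries.
have BB i : koszul_boundaries x Is N i `<=` koszul_boundaries x Is n i.
  by apply: image_subset; apply: LK.
have BZ i : koszul_boundaries x Is n i `<=` koszul_cycles x Is n i.
  exact: koszul_boundaries_cycles.
have k0 : k 0%N = z 0%N.
  rewrite /k; have [_ _ ->] := rn 0%N; rewrite [X in (_ + X)%N](_ : _ = 0%N) ?addn0 //.
  have d0 m : koszul_diff x @` koszul_sub Is m 0 = [set 0].
    apply/seteqP; split=> [_ [u uP <-]|_ ->]; last first.
      by exists 0; [exact: submodule0 (submodule_koszul_sub Is_ideal _ _)|exact: koszul_diff0].
    apply/ffunP => T; rewrite koszul_diffE [RHS]ffunE big1 // => j jT.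
    by have := uP (j |: T)%SET; rewrite cardsU1 jT => ->; rewrite mulr0.
  by rewrite /K /L !d0 length_quoxx //; apply: submodule_set0.
have kS i : k i.+1 = (z i.+1 + b i)%N by have [_ _] := rn i.+1.
have bd : b d = 0%N.
  rewrite /b /koszul_boundaries !(koszul_sub_gt Is_ideal) ?length_quoxx //.
  exact: submodule_image lin _ submodule_set0.
have fZ i : finite_length (koszul_cycles x Is N i) (koszul_cycles x Is n i).
  by have [] := rn i.
have fh i : (i <= d)%N -> koszul_homology_finite x Is n i.
  move=> id; apply: finite_length_sub (fZ i) => //.
  by rewrite -acyc.
split=> //.
have zE i : (i <= d)%N -> z i = (b i + h i)%N.
  move=> id; have := fZ i; rewrite /z /b -acyc // => fBZ.
  by rewrite (@length_quo_add _ _ _ (koszul_boundaries x Is n i)).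
transitivity (\sum_(i < d.+1) (-1) ^+ i * (k i)%:Z); last first.
  by apply: eq_bigr => i _; rewrite /k (length_koszul_sub i nN).2.
transitivity (\sum_(i < d.+1) (-1) ^+ i * ((z i)%:Z - (b i)%:Z)).
  apply: eq_bigr => i _; congr (_ * _); rewrite (zE i (ltn_ord i)) /h; lia.
under eq_bigr do rewrite mulrBr.
(* The ends are b_d = 0 and z_0 = k_0; each remaining b_i is paired with z_(i+1), and the shift of
   index absorbs the minus sign. *)
rewrite sumrB [X in _ - X = _]big_ord_recr /= bd mulr0 addr0.
rewrite big_ord_recl [RHS]big_ord_recl /= k0 -addrA -sumrB; congr (_ + _).
by apply: eq_bigr => i _; rewrite kS PoszD exprS; ring.
Qed.

End KoszulEuler.

(** * Hilbert polynomials *)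

Section FiniteDifferences.

Definition backward_diff (f : int -> int) : int -> int := fun n => f n - f (n - 1).

Lemma iter_backward_diffE d f n : iter d backward_diff f n =
  \sum_(i < d.+1) (-1) ^+ i * ('C(d, i)%:Z * f (n - i%:Z)).
Proof.
elim: d n => [|d IHd] n; first by rewrite big_ord1 expr0 bin0 !mul1r subr0.
rewrite iterS /backward_diff !IHd [RHS]big_ord_recl /= bin0 expr0.
rewrite big_ord_recl /= bin0 expr0 -addrA; congr (_ + _).
under [RHS]eq_bigr => i _.
  rewrite /bump /= binS PoszD mulrDl mulrDr; over.
rewrite big_split /=; congr (_ + _).
  by rewrite [RHS]big_ord_recr /= bin_small // mul0r mulr0 addr0.
rewrite -sumrN; apply: eq_bigr => i _.
rewrite (_ : n - 1 - i%:Z = n - i.+1%:Z); last by lia.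
by rewrite exprS mulN1r mulNr.
Qed.

Lemma iter_backward_diff0 d f n :
  (forall k : int, k <= n -> f k = 0) -> iter d backward_diff f n = 0.
Proof.
by move=> f0; rewrite iter_backward_diffE big1 // => i _; rewrite f0 ?mulr0 //; lia.
Qed.

Lemma backward_diff_const f c (N : int) :
  (forall n : int, N < n -> backward_diff f n = c) ->
  forall n : int, N <= n -> f n = c * (n - N) + f N.
Proof.
move=> fc n Nn; rewrite (_ : n = N + (absz (n - N))%:Z); last by lia.
elim: (absz _) => [|k IHk]; first by rewrite addr0 subrr mulr0 add0r.
have := fc (N + k.+1%:Z); rewrite /backward_diff.
rewrite (_ : N + k.+1%:Z - 1 = N + k%:Z); last by lia.
move=> /(_ _)/eqP; rewrite subr_eq IHk => /(_ ltac:(lia))/eqP->.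
rewrite (_ : k.+1%:Z = k%:Z + 1); last by lia.
ring.
Qed.

Lemma binom_polyE a b (t : rat) :
  (binom_poly a b).[t] = (b`!%:R)^-1 * \prod_(j < b) (t + (a%:~R - j%:R)).
Proof.
rewrite /binom_poly hornerZ horner_prod; congr (_ * _); apply: eq_bigr => j _.
by rewrite !hornerE.
Qed.

Lemma binom_poly0 a (t : rat) : (binom_poly a 0).[t] = 1.
Proof. by rewrite binom_polyE big_ord0 fact0 invr1 mulr1. Qed.

(** Pascal's rule. The two products share all factors but the first of one and the last of the
    other, and these differ by b + 1. *)
Lemma binom_poly_diff a b (t : rat) :
  (binom_poly a b.+1).[t] - (binom_poly a b.+1).[t - 1] = (binom_poly (a - 1) b).[t].
Proof.
rewrite !binom_polyE -mulrBr factS natrM invfM -mulrA mulrCA; congr (_ * _).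
rewrite big_ord_recl [X in _ - X]big_ord_recr /=.
have -> : \prod_(i < b) (t + (a%:~R - (bump 0 i)%:R)) =
          \prod_(i < b) (t + ((a - 1)%:~R - i%:R)).
  by apply: eq_bigr => i _; rewrite /bump /= natrD intrB; ring.
have -> : \prod_(i < b) (t - 1 + (a%:~R - i%:R)) =
          \prod_(i < b) (t + ((a - 1)%:~R - i%:R)).
  by apply: eq_bigr => i _; rewrite intrB; ring.
set p := \prod_(i < b) _.
have -> : (t + (a%:~R - 0%:R)) * p - p * (t - 1 + (a%:~R - b%:R)) = b.+1%:R * p.
  by rewrite -natr1; ring.
by rewrite mulKf // pnatr_eq0.
Qed.

(** Induction on b and then on n + a by Pascal's rule; at n = -a and b > 0 the first factor
    vanishes. *)
Lemma binom_poly_int a b (n : int) : 0 <= n + a ->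
  exists z : int, (binom_poly a b).[n%:~R] = z%:~R.
Proof.
elim: b a n => [|b IHb] a n na; first by exists 1; rewrite binom_poly0.
rewrite (_ : n = (absz (n + a))%:Z - a); last by lia.
elim: (absz _) => [|k [z zE]].
  exists 0; rewrite binom_polyE big_ord_recl /=.
  by rewrite (_ : _ + (_ - _) = 0) ?mul0r ?mulr0 // intrB; ring.
have [|z' z'E] := IHb (a - 1) (k.+1%:Z - a); first lia.
exists (z' + z); rewrite [RHS]intrD -z'E -zE -binom_poly_diff.
rewrite (_ : (k%:Z - a)%:~R = (k.+1%:Z - a)%:~R - 1 :> rat) ?subrK //.
by rewrite -[1]/(1%:~R) -intrB; congr (_%:~R); lia.
Qed.

Definition hilbert_sum d (e : nat -> int) (t : rat) : rat :=
  \sum_(i < d.+1) (-1) ^+ i * (e i)%:~R * (binom_poly (d%:Z - i%:Z - 1) (d - i)).[t].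

Lemma hilbert_sum_diff d e t :
  hilbert_sum d.+1 e t - hilbert_sum d.+1 e (t - 1) = hilbert_sum d e t.
Proof.
rewrite /hilbert_sum big_ord_recr [X in _ - X]big_ord_recr /= subnn !binom_poly0.
rewrite opprD addrACA subrr addr0 -sumrB; apply: eq_bigr => i _.
rewrite -mulrBr (_ : d.+1 - i = (d - i).+1)%N; last by have := ltn_ord i; lia.
rewrite binom_poly_diff; congr (_ * (binom_poly _ _).[_]); lia.
Qed.

Lemma hilbert_sum1 e t : hilbert_sum 1 e t = (e 0%N)%:~R * t - (e 1%N)%:~R.
Proof.
rewrite /hilbert_sum big_ord_recr big_ord1 /= !binom_polyE /= big_ord_recl !big_ord0.
by rewrite /= !fact0 !invr1; ring.
Qed.

(** Each summation determines f up to a constant, which becomes the last coefficient. Only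
    coefficients of index at least 2 arise in this way, so [c0] and [c1] persist. *)
Lemma hilbert_sum_of_diff d (f : int -> int) (c0 c1 N : int) :
  (forall n : int, N <= n -> iter d backward_diff f n = c0 * n - c1) ->
  exists e, [/\ e 0%N = c0, e 1%N = c1 &
    exists N', forall n : int, N' <= n -> (f n)%:~R = hilbert_sum d.+1 e n%:~R].
Proof.
elim: d f => [|d IHd] f fE.
  exists (fun i => if i is 0%N then c0 else c1); split=> //; exists N => n Nn.
  by rewrite hilbert_sum1 [f n](fE n Nn) intrB intrM.
have [|e [e0 e1 [N' eE]]] := IHd (backward_diff f).
  by move=> n; rewrite -iterSr; apply: fE.
(* With M >= 1 all binomials below have a nonnegative upper argument at M, down to M - 1 for the
   last index, so the constant to be added is an integer. *)
pose M := Order.max N' 1.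
have [z zE] : exists z : int, hilbert_sum d.+2 e M%:~R = z%:~R.
  rewrite /hilbert_sum; elim/big_ind: _ => [|_ _ [y ->] [z ->]|i _].
  - by exists 0.
  - by exists (y + z); rewrite intrD.
  - have [|z ->] := @binom_poly_int (d.+2%:Z - i%:Z - 1) (d.+2 - i) M.
      by have := ltn_ord i; rewrite /M; lia.
    by exists ((-1) ^+ i * e i * z); rewrite !intrM rmorphXn rmorphN1.
pose e' i := if i == d.+2 then e i + (-1) ^+ i * (f M - z) else e i.
exists e'; split=> //; exists M => n Mn.
have e'E t : hilbert_sum d.+2 e' t = hilbert_sum d.+2 e t + (f M - z)%:~R.
  rewrite /hilbert_sum big_ord_recr [X in _ = X + _]big_ord_recr /= -[RHS]addrA; congr (_ + _).
    apply: eq_bigr => i _; rewrite /e' (_ : (i == d.+2 :> nat) = false) //.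
    by have := ltn_ord i; lia.
  rewrite /e' eqxx subnn binom_poly0 !mulr1 intrD mulrDr; congr (_ + _).
  by rewrite intrM rmorphXn rmorphN1 mulrA -exprMn mulrNN mulr1 expr1n mul1r.
rewrite e'E (_ : n = M + (absz (n - M))%:Z); last by lia.
elim: (absz _) => [|k IHk]; first by rewrite addr0 zE intrB; ring.
set n1 := M + k.+1%:Z; have n1E : M + k%:Z = n1 - 1 by rewrite /n1; lia.
have : (backward_diff f n1)%:~R = hilbert_sum d.+1 e n1%:~R.
  by apply: eE; rewrite /n1 /M; lia.
rewrite /backward_diff -n1E [LHS]intrB IHk n1E -[hilbert_sum d.+1 e _]hilbert_sum_diff.
rewrite [(n1 - 1)%:~R]intrB => /eqP; rewrite subr_eq => /eqP->; ring.
Qed.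

Lemma diff_of_hilbert_sum d (f : int -> int) e (N : int) :
  (forall n : int, N <= n -> (f n)%:~R = hilbert_sum d.+1 e n%:~R) ->
  forall n : int, N + d%:Z <= n -> iter d backward_diff f n = e 0%N * n - e 1%N.
Proof.
elim: d f N => [|d IHd] f N fE n Nn.
  have Nn' : N <= n by lia.
  have := fE n Nn'; rewrite hilbert_sum1 -intrM -intrB => /intr_inj h; exact: h.
rewrite iterSr; apply: (IHd _ (N + 1)); last by lia.
move=> k Nk; rewrite /backward_diff intrB !fE; [|lia..].
by rewrite intrB hilbert_sum_diff.
Qed.

End FiniteDifferences.

(** * Reading the Chern number off the Hilbert function *)

Section HilbertPolynomials.
Context {R : comNzRingType}.
Variable Is : int -> set R.

Lemma poly_eq_eventually (p q : {poly rat}) N :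
  (forall n : nat, (N <= n)%N -> p.[n%:R] = q.[n%:R]) -> p = q.
Proof.
move=> pq; apply/eqP; rewrite -subr_eq0; apply/contraT => pq0.
pose rs := [seq (n%:R : rat) | n <- iota N (size (p - q))].
have /(_ rs) := max_poly_roots pq0; rewrite size_map size_iota ltnn; apply.
  apply/allP => _ /mapP[n + ->]; rewrite mem_iota => /andP[Nn _].
  by rewrite rootE !hornerE pq // subrr.
by rewrite map_inj_uniq ?iota_uniq // => i j /eqP; rewrite eqr_nat => /eqP.
Qed.

(** The polynomial and its coefficients are values of [xget], so existence has to be shown for both.
    Uniqueness is needed for the polynomial and for e_1 only. *)
Lemma chern_numberE d (c0 c1 N : int) :
  (forall n : int, N <= n ->
     iter d backward_diff (fun k => (hilbert_fun Is k)%:Z) n = c0 * n - c1) ->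
  chern_number d.+1 Is = c1.
Proof.
move=> HE; have [e [e0 e1 [N' eE]]] := hilbert_sum_of_diff HE.
pose P : {poly rat} := \sum_(i < d.+2)
  ((-1) ^+ i * (e i)%:~R) *: binom_poly (d.+1%:Z - i%:Z - 1) (d.+1 - i).
have PE t : P.[t] = hilbert_sum d.+1 e t.
  by rewrite horner_sum; apply: eq_bigr => i _; rewrite hornerZ.
have hP : is_hilbert_poly Is P.
  exists (absz N') => n Nn; rewrite PE -(eE n%:Z) //; lia.
have hilbertE : is_hilbert_poly Is (hilbert_poly Is).
  by rewrite /hilbert_poly; case: xgetP => [Q _|/(_ P)].
have hilbertP : hilbert_poly Is = P.
  have [[M MP] [M' M'P]] := (hP, hilbertE).
  apply: (@poly_eq_eventually _ _ (maxn M M')) => n; rewrite geq_max => /andP[Mn M'n].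
  by rewrite -MP // -M'P.
have : is_hilbert_coefs Is (hilbert_coefs d.+1 Is).
  rewrite /hilbert_coefs; case: xgetP => [Q _ //|/(_ [ffun i : 'I_d.+2 => e i])[]].
  rewrite /is_hilbert_coefs /= hilbertP; apply: eq_bigr => i _.
  by rewrite ffunE.
rewrite /chern_number; set q := hilbert_coefs _ _ => qP.
pose e' i := q (inord i).
have e'E (n : int) : N' <= n -> ((hilbert_fun Is n)%:Z)%:~R = hilbert_sum d.+1 e' n%:~R :> rat.
  move=> /eE ->; rewrite -PE -hilbertP qP horner_sum; apply: eq_bigr => i _.
  by rewrite hornerZ /e' inord_val.
have e'P := diff_of_hilbert_sum e'E.
pose M := Order.max N (N' + d%:Z).
have NM : N <= M by rewrite /M; lia.
have N'M : N' + d%:Z <= M by rewrite /M; lia.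
(* Two affine functions that agree at M and M + 1 have the same coefficients. *)
have := e'P M N'M; have := e'P (M + 1) ltac:(lia).
rewrite !HE //; last by lia.
move=> h1 h2; have e0' : e' 0%N = c0 by lia.
rewrite e0' in h2; rewrite -/(e' 1%N); lia.
Qed.

End HilbertPolynomials.

(** * Admissible filtrations and the proof of the theorem *)

Section AdmissibleFiltrations.
Context {R : comNzRingType}.
Implicit Types (I J m : set R) (Is : int -> set R).

Lemma mem_ideal_mul (A B : set R) a b : A a -> B b -> ideal_mul A B (a * b).
Proof. by move=> Aa Bb; apply: sub_ideal_span; exists a => //; exists b. Qed.

Lemma expr_ideal_exp I a p : I a -> ideal_exp I p (a ^+ p).
Proof.
by move=> Ia; elim: p => [//|p IHp]; rewrite exprS; apply: mem_ideal_mul.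
Qed.

Lemma ideal_mul_scaled_sum d (x : 'I_d -> R) (A : set R) : ideal A ->
  ideal_mul (ideal_span (range x)) A `<=` scaled_sum x (A : set R^o).
Proof.
move=> iA; have sxA := submodule_scaled_sum x (iA : submodule (A : set R^o)).
apply: ideal_span_sub => // _ [b Jb [a Aa <-]].
have : scaled_sum x (setT : set R^o) b.
  apply: (ideal_span_sub _ _ Jb); first exact: submodule_scaled_sum.
  move=> _ [j _ <-]; rewrite -[x j]mulr1; exact: (@mem_scaled_sum R R^o).
move=> [c [_ ->]]; exists (fun j => c j * a); split=> [j|].
  exact: (submoduleZ (c j) iA).
by rewrite mulr_suml; apply: eq_bigr => j _; rewrite /GRing.scale /= mulrA.
Qed.

Lemma admissible_colength m I Is (n : int) :
  noetherian R -> maximal_ideal m -> primary_to m I -> admissible_filtration I Is ->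
  finite_length (Is n : set R^o) (setT : set R^o).
Proof.
move=> noeR mmax [_ radI] [iIs [k kP]].
apply: (finite_colength noeR mmax) => // a; rewrite -radI => -[l Il].
have [_ _ sub _] := kP 0 n; case: n sub => p sub; last by exists 0%N; apply: sub.
by exists (l * p)%N; rewrite exprM; apply: sub; apply: expr_ideal_exp.
Qed.

End AdmissibleFiltrations.

Theorem theorem1p1 (R : comNzRingType) (m : set R) (d : nat)
    (R_noetherian : noetherian R) (R_local : local_ring m)
    (d_ge1 : (1 <= d)%N) (R_dim : krull_dim R d)
    (residue_infinite : infinite_set (quotient_cosets m))
    (I : set R) (I_primary : primary_to m I)
    (Is : int -> set R) (Is_admissible : admissible_filtration I Is)
    (x : 'I_d -> R) (x_in_I : forall i, I (x i))
    (x_reduction : minimal_reduction_of Is (ideal_span (range x))) :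
  (forall (n : nat) (i : nat), (1 <= n)%N -> (i <= d)%N ->
     koszul_homology_finite x Is n%:Z i) /\
  int_series_sum (fun n : nat => koszul_euler x Is n%:Z) (chern_number d Is).
Proof.
have [mmax _] := R_local.
have Is_colength n := admissible_colength n R_noetherian mmax I_primary Is_admissible.
have [Is_ideal [k kP]] := Is_admissible.
have Is_decr n : Is (n + 1) `<=` Is n by have [] := kP 0 n.
have Is_T n : n <= 0 -> Is n = setT.
  move=> n0; apply/seteqP; split=> // a _; have [_ _ + _] := kP 0 n; apply.
  by case: n n0 => [[|p]|p].
have Is_scale n j a : Is n a -> Is (n + 1) (x j * a).
  move=> Ia; rewrite addrC; have [_ + _ _] := kP 1 n; apply; apply: mem_ideal_mul => //.
  have [_ _ + _] := kP 0 1; apply; rewrite -[x j]mulr1.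
  exact: mem_ideal_mul.
have [[_ _ [n0 n0P]] _] := x_reduction.
have [|N NP] := koszul_acyclic Is_ideal Is_scale _ (noetherian_acc R_noetherian) (n0 := n0).
  by move=> n /n0P <-; apply: ideal_mul_scaled_sum.
have euler (n M : int) : n <= M -> N <= M -> (forall i, (i <= d)%N ->
     koszul_homology_finite x Is n i) /\ koszul_euler x Is n =
    iter d backward_diff (fun l => (hilbert_fun Is l)%:Z) M
    - iter d backward_diff (fun l => (hilbert_fun Is l)%:Z) n.
  move=> nM NM; have [|fin ->] :=
    koszul_euler_formula Is_ideal Is_decr Is_scale Is_colength nM.
    by move=> i; apply: NP.
  split=> //; rewrite !iter_backward_diffE -sumrB; apply: eq_bigr => i _.
  by rewrite !mulrBr.
split=> [n i _|].
  by have [||fin _] := euler n%:Z (Order.max n%:Z N); [lia|lia|apply: fin].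
have eulerN (n : int) : N <= n -> koszul_euler x Is n = 0.
  move=> Nn; rewrite /koszul_euler big1 // => i _.
  rewrite /koszul_homology_length (NP _ _ Nn (ltn_ord i)) length_quoxx ?mulr0 //.
  exact: submodule_koszul_cycles.
(* Write the dimension as d + 1, so that g below is the difference of H of order one less than the
   dimension. *)
case: d d_ge1 x euler eulerN {R_dim x_in_I x_reduction Is_scale n0P NP} => // d _ x euler eulerN.
set h := fun l => (hilbert_fun Is l)%:Z in euler.
pose c0 := iter d.+1 backward_diff h N.
pose g := iter d backward_diff h.
pose c1 := c0 * N - g N.
have eulerE (n : int) : koszul_euler x Is n = c0 - (g n - g (n - 1)).
  pose M := Order.max n N.
  have nM : n <= M by rewrite /M; lia.
  have NM : N <= M by rewrite /M; lia.
  rewrite (euler n M nM NM).2; congr (_ - _).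
  (* The formula at n = N, where the Euler characteristic is 0, shows that the top difference of H
     takes the same value [c0] at M as at N. *)
  apply/eqP; rewrite -subr_eq0 -(euler N M NM NM).2; apply/eqP.
  by apply: eulerN.
have gE (n : int) : N <= n -> g n = c0 * n - c1.
  move=> Nn; rewrite (@backward_diff_const g c0 N) //; first by rewrite /c1; ring.
  move=> l Nl; apply/eqP; rewrite eq_sym -subr_eq0 -eulerE; apply/eqP; apply: eulerN.
  exact: ltW.
rewrite (chern_numberE gE).
(* The starting value of the telescoping sum: I_l = R for l <= 0, so H vanishes there. *)
have g0 : g 0 = 0.
  apply: iter_backward_diff0 => l l0.
  by rewrite /h /hilbert_fun Is_T // length_quoxx.
exists (absz N) => M NM.
have -> : \sum_(1 <= n < M.+1) koszul_euler x Is n%:Z = c0 * M%:Z - g M%:Z.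
  elim: M {NM} => [|M IHM]; first by rewrite big_geq // mulr0 g0 subr0.
  rewrite big_nat_recr //= IHM eulerE.
  rewrite (_ : M.+1%:Z - 1 = M%:Z); last by lia.
  rewrite (_ : M.+1%:Z = M%:Z + 1); last by lia.
  ring.
rewrite gE; last by lia.
ring.
Qed.
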